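(* Suppose there is a language $L \in \mathrm{coNP}$ such that $L \notin \mathrm{io}\,\mathrm{NP/poly}$. Then every $\mathrm{NP}$-complete language $A$ is complete for $\mathrm{NP}$ via length-increasing $\mathrm{P/poly}$-computable reductions; that is, for every $B\in\mathrm{NP}$ there is a function $f$ computable by a polynomial-size circuit family such that for all $x$, $x\in B\iff f(x)\in A$, and $|f(x)|>|x|$.
   Context: Languages are over $\Sigma=\{0,1\}$; $A_n$ denotes the characteristic sequence of $A$ on strings of length $n$. A language $L$ is in $\mathrm{NP/poly}$ if there is a polynomial-size circuit family $C$ and a polynomial $p$ such that for every $x$, $x\in L$ iff there is $y$ of length $p(|x|)$ with $C(x,y)=1$. For languages $A,B$, write $A =_{\mathrm{io}} B$ if $A_n=B_n$ for infinitely many $n$; for a class $\mathcal{C}$, $A\in\mathrm{io}\,\mathcal{C}$ if there is $B\in\mathcal{C}$ with $A=_{\mathrm{io}}B$. ''$\mathrm{NP}$-complete'' means complete under polynomial-time many-one reductions. *)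

(* Defs.v *)
From mathcomp Require Import all_boot.
Set Implicit Arguments. Unset Strict Implicit. Unset Printing Implicit Defensive.

Definition language := seq bool -> Prop.

Definition poly_fun (p : nat -> nat) : Prop :=
  exists a : seq nat, forall n, p n = \sum_(i < size a) nth 0 a i * n ^ i.

Inductive sym := Blank | Zero | One | Sep.
Inductive move := MLeft | MRight | MStay.

(* finitely many states 'I_(tm_n).+1, start state ord0 *)
Record TM := {
  tm_n : nat;
  tm_delta : 'I_(tm_n).+1 -> sym -> 'I_(tm_n).+1 * sym * move;
  tm_halt : 'I_(tm_n).+1 -> bool }.

(* configuration: state, left part of tape (reversed), head symbol, right part *)
Definition config (M : TM) := ('I_(tm_n M).+1 * seq sym * sym * seq sym)%type.

Definition tm_init (M : TM) (w : seq sym) : config M :=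
  (ord0, [::], head Blank w, behead w).

Definition tm_step (M : TM) (c : config M) : config M :=
  let: (q, l, h, r) := c in
  if tm_halt q then c else
  let: (q', s, m) := tm_delta q h in
  match m with
  | MStay => (q', l, s, r)
  | MLeft => match l with
             | [::] => (q', [::], Blank, s :: r)
             | a :: l' => (q', l', a, s :: r)
             end
  | MRight => match r with
              | [::] => (q', s :: l, Blank, [::])
              | a :: r' => (q', s :: l, a, r')
              end
  end.

Definition tm_run (M : TM) (w : seq sym) (t : nat) : config M :=
  iter t (tm_step (M:=M)) (tm_init M w).

Definition tm_halted (M : TM) (c : config M) : bool :=
  let: (q, _, _, _) := c in tm_halt q.

Fixpoint syms_out (s : seq sym) : seq bool :=
  match s with
  | Zero :: s' => false :: syms_out s'
  | One :: s' => true :: syms_out s'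
  | _ => [::]
  end.

Definition tm_output (M : TM) (c : config M) : seq bool :=
  let: (_, _, h, r) := c in syms_out (h :: r).

Definition enc (x : seq bool) : seq sym := map (fun b => if b then One else Zero) x.
Definition enc_pair (x y : seq bool) : seq sym := enc x ++ Sep :: enc y.

Definition FP (f : seq bool -> seq bool) : Prop :=
  exists (M : TM) (p : nat -> nat), poly_fun p /\
    forall x, tm_halted (tm_run M (enc x) (p (size x))) /\
              tm_output (tm_run M (enc x) (p (size x))) = f x.

Definition NP (L : language) : Prop :=
  exists (M : TM) (p q : nat -> nat), poly_fun p /\ poly_fun q /\
    (forall x y, size y = q (size x) ->
       tm_halted (tm_run M (enc_pair x y) (p (size x)))) /\
    (forall x, L x <-> exists y, size y = q (size x) /\
       tm_output (tm_run M (enc_pair x y) (p (size x))) = [:: true]).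

Definition coNP (L : language) : Prop := NP (fun x => ~ L x).

Definition NP_complete (A : language) : Prop :=
  NP A /\ forall B, NP B -> exists f, FP f /\ forall x, B x <-> A (f x).

(* straight-line program: wire i is the value of gate i; gates may only read
   earlier wires (references to non-earlier wires read as false) *)
Inductive gate :=
  | GIn of nat | GConst of bool | GNot of nat
  | GAnd of nat & nat | GOr of nat & nat.

Record circuit := { c_gates : seq gate; c_outs : seq nat }.

Definition csize (C : circuit) : nat := size (c_gates C) + size (c_outs C).

Definition gate_val (x vals : seq bool) (g : gate) : bool :=
  match g with
  | GIn j => nth false x j
  | GConst b => b
  | GNot j => ~~ nth false vals j
  | GAnd j k => nth false vals j && nth false vals k
  | GOr j k => nth false vals j || nth false vals k
  end.

Definition wire_vals (gs : seq gate) (x : seq bool) : seq bool :=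
  foldl (fun vals g => rcons vals (gate_val x vals g)) [::] gs.

Definition ceval (C : circuit) (x : seq bool) : seq bool :=
  let vals := wire_vals (c_gates C) x in map (fun i => nth false vals i) (c_outs C).

Definition caccepts (C : circuit) (x : seq bool) : bool := head false (ceval C x).

Definition poly_size (C : nat -> circuit) : Prop :=
  exists q, poly_fun q /\ forall n, csize (C n) <= q n.

Definition NPpoly (L : language) : Prop :=
  exists (C : nat -> circuit) (p : nat -> nat), poly_size C /\ poly_fun p /\
    forall x, L x <-> exists y, size y = p (size x) /\
       caccepts (C (size (x ++ y))) (x ++ y).

Definition io_eq (A B : language) : Prop :=
  forall m, exists n, m <= n /\ forall x, size x = n -> (A x <-> B x).

Definition ioNPpoly (L : language) : Prop := exists B, NPpoly B /\ io_eq L B.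

(* functions computed by circuit families: C (|x|) is applied to x; since a
   circuit has a fixed number of outputs, variable-length values are encoded as
   pairs of bits (valid, value); the string is the sequence of valid values *)
Fixpoint decode (s : seq bool) : seq bool :=
  match s with
  | v :: b :: s' => if v then b :: decode s' else decode s'
  | _ => [::]
  end.

Definition circ_fun (C : nat -> circuit) (x : seq bool) : seq bool :=
  decode (ceval (C (size x)) x).

(* Main.v *)
(** Let [K] be the complement of [L], an NP language. A circuit-valued problem [U]
    in NP receives, through a small circuit, the question "some [x_i] is in [K],
    or [y] is in [B]"; let [h] be the composition with a reduction of [U] to
    [A]. If all [x_i] are in [L], then [h (x_1 ... x_t, y)] is a question about [y]
    only, so it remains to find few tuples over [L] at least one of which
    makes [h] long, for every [y] outside [B]. If there are none, then
    for some [y] half of the tuples have short outputs, and since there are few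
    short strings, one of them is the output of so many tuples that
    these involve half of [L] at this length (the distillation argument of
    Fortnow and Santhanam). Iterating gives a short list of pairs [(y, z)] with
    [y] outside [B] and [z] outside [A] such that [x] is in [L] iff [x] is an entry of
    some tuple with output [z] on [y]: this puts [L] in NP/poly at this length.
    For inputs [y] with no long output under the hardwired tuples, [y] must be in
    [B], and the circuit prints a fixed long element of [A], which exists by the
    same argument. *)

From HB Require Import structures.
From Stdlib Require Import Classical IndefiniteDescription.
Require Import Defs.
From mathcomp Require Import all_boot zify.
Set Implicit Arguments. Unset Strict Implicit. Unset Printing Implicit Defensive.

(** * Polynomial bounds *)

(** Completeness of [A] speaks of languages accepted by Turing machines, while the question to be
    reduced comes from two verifiers and varies with the length. Instances of [U] are therefore
    programs: a single explicit machine runs straight-line programs, both verifiers become circuits,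
    and since the reduction sought is nonuniform, a circuit may write the program. The string [y]
    consists of a flag and a string of length n; a question with flag 0 asks nothing about [B]. This
    supplies negative questions at every length, even where [B] contains all strings. Outputs of
    length at most n are stored in k = 2(n+1) bits, and tuples have k+1 entries. If S is the part of
    [L] still to be covered and S' the set of entries of the tuples over S with the popular output,
    then |S|^(k+1) <= 2 * 2^k * |S'|^(k+1), hence |S| <= 2 |S'|. Hardness of [L] excludes short
    advice from some length on; the finitely many shorter lengths are served by tables, which need a
    long element and a long non-element of [A]. *)

Definition polyb (s : nat -> nat) := exists c, forall n, s n <= n.+2 ^ c.

Lemma polyb_le s s' : (forall n, s n <= s' n) -> polyb s' -> polyb s.
Proof. by move=> h [c hc]; exists c => n; apply: leq_trans (hc n). Qed.

Lemma polyb_const k : polyb (fun=> k).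
Proof.
exists k => n; apply: ltnW; apply: leq_trans (ltn_expl k (isT : 1 < 2)) _.
by case: k => // k; rewrite leq_exp2r.
Qed.

Lemma polyb_id : polyb id.
Proof. by exists 1 => n; rewrite expn1; lia. Qed.

Lemma polyb_mul s s' : polyb s -> polyb s' -> polyb (fun n => s n * s' n).
Proof. by move=> [c hc] [d hd]; exists (c + d) => n; rewrite expnD leq_mul. Qed.

(** The base [n.+2] is at least 2, so the factor 2 of a sum costs one more exponent and the bounds
    need no coefficients. *)
Lemma polyb_add s s' : polyb s -> polyb s' -> polyb (fun n => s n + s' n).
Proof.
move=> [c hc] [d hd]; exists (c + d).+1 => n; rewrite expnS expnD.
have := hc n; have := hd n.
have : 0 < n.+2 ^ c by rewrite expn_gt0.
have : 0 < n.+2 ^ d by rewrite expn_gt0.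
by nia.
Qed.

Lemma polyb_S s : polyb s -> polyb (fun n => (s n).+1).
Proof.
by move=> h; apply: polyb_le (polyb_add (polyb_const 1) h) => n; rewrite add1n.
Qed.

Lemma leq_exp_base m n e : m <= n -> m ^ e <= n ^ e.
Proof. by case: e => // e; rewrite leq_exp2r. Qed.

Lemma polyb_pow s k : polyb s -> polyb (fun n => s n ^ k).
Proof.
by move=> [c hc]; exists (c * k) => n; rewrite expnM leq_exp_base.
Qed.

Ltac solve_polyb := by do ?[apply: polyb_mul|apply: polyb_add|apply: polyb_S|apply: polyb_pow
  |apply: polyb_const|apply: polyb_id|assumption].

Lemma poly_fun_polyb p : poly_fun p -> polyb p.
Proof.
move=> [a ha]; apply: (@polyb_le _ (fun n => \sum_(i < size a) nth 0 a i * n ^ i)).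
  by move=> n; rewrite ha.
elim: (size a) => [|k IH].
  by apply: polyb_le (polyb_const 0) => n; rewrite big_ord0.
apply: polyb_le (polyb_add IH (polyb_mul (polyb_const (nth 0 a k)) (polyb_pow k polyb_id))).
by move=> n; rewrite big_ord_recr.
Qed.

Lemma polyb_poly_fun s : polyb s -> exists q, poly_fun q /\ forall n, s n <= q n.
Proof.
move=> [c hc].
(* For positive [n], [n.+2 <= 3 * n]; the constant term serves [n = 0]. The exponent [c.+1] is
   positive, so the two coefficients occupy different places of the list. *)
exists (fun n => 2 ^ c.+1 + 3 ^ c.+1 * n ^ c.+1); split.
  exists (2 ^ c.+1 :: rcons (nseq c 0) (3 ^ c.+1)) => n.
  rewrite /= size_rcons size_nseq big_ord_recl big_ord_recr /= muln1 nth_rcons.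
  rewrite size_nseq ltnn eqxx big1 // => i _.
  by rewrite nth_rcons size_nseq /= ltn_ord nth_nseq ltn_ord.
move=> n; apply: leq_trans (hc n) _; apply: (@leq_trans (n.+2 ^ c.+1)).
  by rewrite leq_exp2l.
case: n => [|n]; first by apply: leq_trans (leq_addr _ _).
rewrite -expnMn; apply: leq_trans (leq_addl _ _); rewrite leq_exp2r //; lia.
Qed.

(** * Circuits *)

Lemma wire_vals_rcons gs g x :
  wire_vals (rcons gs g) x = rcons (wire_vals gs x) (gate_val x (wire_vals gs x) g).
Proof. by rewrite /wire_vals -cats1 foldl_cat. Qed.

Lemma size_wire_vals gs x : size (wire_vals gs x) = size gs.
Proof. by elim/last_ind: gs => // gs g IH; rewrite wire_vals_rcons !size_rcons IH. Qed.

Definition shift_gate k (inp : nat -> gate) (g : gate) : gate :=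
  match g with
  | GIn j => inp j
  | GConst b => GConst b
  | GNot j => GNot (k + j)
  | GAnd i j => GAnd (k + i) (k + j)
  | GOr i j => GOr (k + i) (k + j)
  end.

(** The second program runs after the first, its input gates replaced by gates that find the bits of
    [y] in [x] or in the earlier wires. A reference to a non-earlier wire remains one after the
    shift and still reads [false]. *)
Lemma wire_vals_shift gs1 gs2 inp x y :
  (forall j vals, gate_val x (wire_vals gs1 x ++ vals) (inp j) = nth false y j) ->
  wire_vals (gs1 ++ map (shift_gate (size gs1) inp) gs2) x =
  wire_vals gs1 x ++ wire_vals gs2 y.
Proof.
move=> hinp; elim/last_ind: gs2 => [|gs g IH]; first by rewrite !cats0.
rewrite map_rcons -rcons_cat !wire_vals_rcons IH -rcons_cat; congr rcons.
have nthS j : nth false (wire_vals gs1 x ++ wire_vals gs y) (size gs1 + j) =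
              nth false (wire_vals gs y) j.
  by rewrite nth_cat size_wire_vals ltnNge leq_addr /= addKn.
by case: g => [j|b|j|j k|j k] //=; rewrite ?nthS.
Qed.

(* A dangling output reads [false] but would be captured by a gate appended
   later, so composing circuits needs its absence. *)
Definition cwf (C : circuit) := all (fun o => o < size (c_gates C)) (c_outs C).

Definition cc (I s : nat) (F : seq bool -> seq bool) :=
  exists C, [/\ cwf C, csize C <= s & forall x, size x = I -> ceval C x = F x].

Lemma cc_ext I s F G : (forall x, size x = I -> F x = G x) -> cc I s F -> cc I s G.
Proof. by move=> h [C [w sz hC]]; exists C; split=> // x hx; rewrite hC ?h. Qed.

Lemma cc_le I s s' F : s <= s' -> cc I s F -> cc I s' F.
Proof. by move=> h [C [w sz hC]]; exists C; split=> //; apply: leq_trans h. Qed.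

Lemma cc_comp I J s s' F G : cc I s F -> (forall x, size x = I -> size (F x) = J) ->
  cc J s' G -> cc I (s + s') (fun x => G (F x)).
Proof.
move=> [[gs1 o1] [/= w1 sz1 h1]] hJ [[gs2 o2] [/= w2 sz2 h2]].
(* There is no copying gate; the disjunction of a wire with itself replaces it. Inputs past the
   outputs of the first circuit read as [false]. *)
pose inp j := if j < size o1 then GOr (nth 0 o1 j) (nth 0 o1 j) else GConst false.
exists {| c_gates := gs1 ++ map (shift_gate (size gs1) inp) gs2;
          c_outs := map (addn (size gs1)) o2 |}; split.
- rewrite /cwf /= all_map; apply: sub_all w2 => o /=.
  by rewrite size_cat size_map ltn_add2l.
- rewrite /csize /= size_cat !size_map -addnA leq_add // .
  by apply: leq_trans sz1; rewrite leq_addr.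
move=> x hx; rewrite -h2 ?hJ // -(h1 _ hx) /ceval /=.
rewrite (@wire_vals_shift _ _ _ _ [seq nth false (wire_vals gs1 x) i | i <- o1]).
  rewrite -map_comp; apply: eq_map => o /=.
  by rewrite nth_cat size_wire_vals ltnNge leq_addr /= addKn.
move=> j vals; rewrite /inp; case: ltnP => hj /=; last first.
  by rewrite nth_default ?size_map.
rewrite orbb (nth_map 0) // nth_cat size_wire_vals.
by rewrite (all_nthP 0 w1).
Qed.

Lemma cc_cat I s s' F G : cc I s F -> cc I s' G -> cc I (s + s') (fun x => F x ++ G x).
Proof.
move=> [[gs1 o1] [/= w1 sz1 h1]] [[gs2 o2] [/= w2 sz2 h2]].
exists {| c_gates := gs1 ++ map (shift_gate (size gs1) GIn) gs2;
          c_outs := o1 ++ map (addn (size gs1)) o2 |}; split.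
- rewrite /cwf /= all_cat all_map size_cat size_map; apply/andP; split.
    by apply: sub_all w1 => o /= ho; apply: leq_trans ho _; rewrite leq_addr.
  by apply: sub_all w2 => o /=; rewrite ltn_add2l.
- move: sz1 sz2; rewrite /csize /= !size_cat !size_map; lia.
move=> x hx; rewrite -h1 // -h2 // /ceval /= (@wire_vals_shift _ _ _ _ x) //.
rewrite map_cat -map_comp; congr (_ ++ _); last first.
  apply: eq_map => o /=.
  by rewrite nth_cat size_wire_vals ltnNge leq_addr /= addKn.
apply/eq_in_map => o ho; rewrite nth_cat size_wire_vals.
by rewrite (allP w1 _ ho).
Qed.

Lemma cc_nil I : cc I 0 (fun=> [::]).
Proof. by exists {| c_gates := [::]; c_outs := [::] |}. Qed.

Lemma cc_flatten (T : eqType) I s (r : seq T) (F : T -> seq bool -> seq bool) :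
  (forall i, i \in r -> cc I s (F i)) ->
  cc I (size r * s) (fun x => flatten [seq F i x | i <- r]).
Proof.
elim: r => [|i r IH] h; first exact: cc_nil.
rewrite mulSn; apply: cc_cat; first by apply: h; rewrite mem_head.
by apply: IH => j hj; apply: h; rewrite inE hj orbT.
Qed.

Definition bc I s (b : seq bool -> bool) := cc I s (fun x => [:: b x]).

Lemma bc_ext I s b b' : (forall x, size x = I -> b x = b' x) -> bc I s b -> bc I s b'.
Proof. by move=> h; apply: cc_ext => x /h ->. Qed.

Lemma bc_in I j : bc I 2 (fun x => nth false x j).
Proof. by exists {| c_gates := [:: GIn j]; c_outs := [:: 0] |}. Qed.

Lemma bc_const I b : bc I 2 (fun=> b).
Proof. by exists {| c_gates := [:: GConst b]; c_outs := [:: 0] |}. Qed.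

Lemma cc_map (T : eqType) I s (r : seq T) (b : T -> seq bool -> bool) :
  (forall i, i \in r -> bc I s (b i)) -> cc I (size r * s) (fun x => [seq b i x | i <- r]).
Proof.
move=> h; apply: cc_ext (cc_flatten h) => x _.
by elim: (r) => //= i r' ->.
Qed.

Lemma cc_const I (w : seq bool) : cc I (size w * 2) (fun=> w).
Proof.
apply: cc_ext (@cc_map _ I 2 w (fun b _ => b) _) => [x _|b _]; first exact: map_id.
exact: bc_const.
Qed.

Lemma cc_sel I (r : seq nat) : cc I (size r * 2) (fun x => [seq nth false x i | i <- r]).
Proof. by apply: cc_map => i _; apply: bc_in. Qed.

Lemma bc_not I s b : bc I s b -> bc I (s + 3) (fun x => ~~ b x).
Proof.
move=> h; apply: (@cc_comp I 1 s 3 _ (fun x => [:: ~~ nth false x 0]) h) => //.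
by exists {| c_gates := [:: GIn 0; GNot 0]; c_outs := [:: 1] |}.
Qed.

Lemma bc_and I s s' b b' : bc I s b -> bc I s' b' ->
  bc I (s + s' + 4) (fun x => b x && b' x).
Proof.
move=> h h'.
apply: (@cc_comp I 2 _ 4 _ (fun x => [:: nth false x 0 && nth false x 1]) (cc_cat h h')) => //.
by exists {| c_gates := [:: GIn 0; GIn 1; GAnd 0 1]; c_outs := [:: 2] |}.
Qed.

Lemma bc_or I s s' b b' : bc I s b -> bc I s' b' ->
  bc I (s + s' + 4) (fun x => b x || b' x).
Proof.
move=> h h'.
apply: (@cc_comp I 2 _ 4 _ (fun x => [:: nth false x 0 || nth false x 1]) (cc_cat h h')) => //.
by exists {| c_gates := [:: GIn 0; GIn 1; GOr 0 1]; c_outs := [:: 2] |}.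
Qed.

Lemma bc_all (T : eqType) I s (r : seq T) (b : T -> seq bool -> bool) :
  (forall i, i \in r -> bc I s (b i)) -> bc I (2 + size r * (s + 4)) (fun x => all (b^~ x) r).
Proof.
elim: r => [|i r IH] h; first exact: bc_const.
apply: cc_le (bc_and (h i (mem_head _ _)) (IH _)) => [|j hj]; first by rewrite /=; lia.
by apply: h; rewrite inE hj orbT.
Qed.

Lemma bc_has (T : eqType) I s (r : seq T) (b : T -> seq bool -> bool) :
  (forall i, i \in r -> bc I s (b i)) -> bc I (2 + size r * (s + 4)) (fun x => has (b^~ x) r).
Proof.
elim: r => [|i r IH] h; first exact: bc_const.
apply: cc_le (bc_or (h i (mem_head _ _)) (IH _)) => [|j hj]; first by rewrite /=; lia.
by apply: h; rewrite inE hj orbT.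
Qed.

Lemma bc_if I s1 s2 s3 b b1 b2 : bc I s1 b -> bc I s2 b1 -> bc I s3 b2 ->
  bc I (s1 + s1 + s2 + s3 + 15) (fun x => if b x then b1 x else b2 x).
Proof.
move=> h h1 h2; apply: bc_ext (cc_le _ (bc_or (bc_and h h1) (bc_and (bc_not h) h2))).
  by move=> x _; case: (b x); rewrite /= ?orbF.
by lia.
Qed.

Lemma bc_nth I s F j : cc I s F -> bc I (s + 2) (fun x => nth false (F x) j).
Proof.
move=> [[gs o] [w sz h]]; have [hj|hj] := ltnP j (size o); last first.
  apply: bc_ext (cc_le _ (bc_const I false)) => [x hx|]; last by rewrite leq_addl.
  by rewrite nth_default // -h // /ceval size_map.
exists {| c_gates := gs; c_outs := [:: nth 0 o j] |}; split.
- by rewrite /cwf /= (all_nthP 0 w).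
- by move: sz; rewrite /csize /=; lia.
by move=> x hx; rewrite -h // /ceval /= (nth_map 0).
Qed.

(** The test and both branches are computed once, and then a multiplexer of size 23 selects each
    output bit; nested conditionals thus add sizes instead of multiplying them. *)
Lemma cc_if I O s1 s2 s3 b F1 F2 : bc I s1 b -> cc I s2 F1 -> cc I s3 F2 ->
  (forall x, size x = I -> size (F1 x) = O) -> (forall x, size x = I -> size (F2 x) = O) ->
  cc I (s1 + s2 + s3 + O * 23) (fun x => if b x then F1 x else F2 x).
Proof.
move=> h h1 h2 z1 z2.
pose G (v : seq bool) :=
  [seq if nth false v 0 then nth false v i.+1 else nth false v (O + i).+1 | i <- iota 0 O].
have hG : cc (O + O).+1 (O * 23) G.
  have := @cc_map _ (O + O).+1 23 (iota 0 O)
    (fun i v => if nth false v 0 then nth false v i.+1 else nth false v (O + i).+1).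
  rewrite size_iota; apply=> i _.
  apply: cc_le (bc_if (bc_in _ _) (bc_in _ _) (bc_in _ _)); lia.
have hc := cc_comp (cc_cat h (cc_cat h1 h2)) _ hG.
apply: cc_ext (cc_le _ (hc _)) => [x hx||x hx]; last first.
- by rewrite /= size_cat z1 ?z2.
- lia.
apply: (@eq_from_nth _ false); rewrite size_map size_iota.
  by case: ifP; rewrite ?z1 ?z2.
move=> i hi; rewrite (nth_map 0) ?size_iota // nth_iota //= add0n nth_cat z1 // hi.
rewrite nth_cat z1 // ltnNge leq_addr /= addKn.
by case: (b x).
Qed.

(* A Boolean function of a bounded number of bits has a circuit of bounded
   size, by branching on one bit after the other. *)
Lemma bc_local k : exists s, forall g, bc k s g.
Proof.
elim: k => [|k [s IH]].
  by exists 2 => g; apply: bc_ext (bc_const 0 (g [::])) => -[].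
exists (2 + 2 + (k * 2 + s) + (k * 2 + s) + 15) => g.
pose tl x := [seq nth false x i | i <- iota 1 k].
have hb b : bc k.+1 (k * 2 + s) (fun x => g (b :: tl x)).
  rewrite -{2}(size_iota 1 k).
  apply: (@cc_comp _ k _ _ tl (fun x => [:: g (b :: x)])); first exact: cc_sel.
    by move=> x _; rewrite size_map size_iota.
  exact: (IH (fun x => g (b :: x))).
apply: bc_ext (bc_if (bc_in _ 0) (hb true) (hb false)) => -[|b x] //= [hx].
have -> : tl (b :: x) = x; last by case: b.
apply: (@eq_from_nth _ false); rewrite size_map size_iota //.
by move=> i hi; rewrite (nth_map 0) ?size_iota // nth_iota.
Qed.

(** The size depends only on the number of bits read, not on their positions or on the input length;
    this makes a machine step linear in the number of tape cells. *)
Lemma bc_local_sel k : exists s, forall I g (r : seq nat), size r = k ->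
  bc I s (fun x => g [seq nth false x i | i <- r]).
Proof.
have [s hs] := bc_local k; exists (k * 2 + s) => I g r hr.
rewrite -hr; apply: (@cc_comp _ k _ _ _ (fun x => [:: g x])); first exact: cc_sel.
  by move=> x _; rewrite size_map.
exact: hs.
Qed.

(** No bound on the size is claimed: this serves only the finitely many lengths below a
    threshold. *)
Lemma cc_table I O (F : seq bool -> seq bool) :
  (forall x, size x = I -> size (F x) = O) -> exists s, cc I s F.
Proof.
move=> hO; have [s hs] := bc_local I; exists (O * s).
apply: cc_ext (_ : cc I _ (fun x => [seq nth false (F x) i | i <- iota 0 O])) => [x hx|].
  by rewrite map_nth_iota0 ?hO // -(hO x hx) take_size.
by rewrite -{1}(size_iota 0 O); apply: cc_map => i _; apply: hs.
Qed.

Lemma size_flatten_const (T : eqType) (U : Type) k (f : T -> seq U) (r : seq T) :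
  (forall i, i \in r -> size (f i) = k) -> size (flatten [seq f i | i <- r]) = size r * k.
Proof.
elim: r => //= i r IH h; rewrite size_cat h ?mem_head // IH // => j hj.
by apply: h; rewrite inE hj orbT.
Qed.

Lemma nth_flatten_const (T U : Type) (x0 : T) (u0 : U) k (f : T -> seq U) r i j :
  (forall a, size (f a) = k) -> i < size r -> j < k ->
  nth u0 (flatten [seq f a | a <- r]) (i * k + j) = nth u0 (f (nth x0 r i)) j.
Proof.
move=> h; elim: r i => //= a r IH [|i] hi hj; rewrite nth_cat h.
  by rewrite add0n hj.
by rewrite mulSn ltnNge -addnA leq_addr /= addKn IH.
Qed.

(** * Simulating Turing machines by circuits *)

Lemma cc_dep k O : exists s, forall I r (F : seq bool -> seq bool), size r = k ->
  (forall x, size x = I -> size (F x) = O) ->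
  (forall x y, size x = I -> size y = I ->
     {in r, forall i, nth false x i = nth false y i} -> F x = F y) ->
  cc I s F.
Proof.
have [s hs] := bc_local_sel k; exists (O * s) => I r F hr hO hF.
(* An input rebuilt from its bits at the positions [r]; at any other position the index is out of
   range and gives [false]. *)
pose un v := [seq nth false v (index i r) | i <- iota 0 I].
apply: cc_ext (_ : cc I _ (fun x =>
    [seq nth false (F (un [seq nth false x i | i <- r])) i | i <- iota 0 O])) => [x hx|].
  have -> : F (un [seq nth false x i | i <- r]) = F x.
    apply: hF => //; first by rewrite size_map size_iota.
    move=> i hi; case: (ltnP i I) => hiI; last by rewrite !nth_default ?hx // size_map size_iota.
    rewrite (nth_map 0) ?size_iota // nth_iota // (nth_map 0) ?index_mem //.
    by rewrite nth_index.
  by rewrite map_nth_iota0 ?hO // -(hO x hx) take_size.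
rewrite -{1}(size_iota 0 O); apply: cc_map => i _.
by apply: (hs _ (fun v => nth false (F (un v)) i)).
Qed.

(** A fixed-length form of strings of varying length, in the format that [decode] reads; strings
    longer than [K] are truncated. *)
Definition code K (z : seq bool) : seq bool :=
  flatten [seq [:: i < size z; nth false z i] | i <- iota 0 K].

Lemma size_code K z : size (code K z) = K * 2.
Proof. by rewrite (@size_flatten_const _ _ 2) ?size_iota. Qed.

Lemma codeS K z : code K.+1 z = [:: 0 < size z; nth false z 0] ++ code K (behead z).
Proof.
rewrite /code /= (iotaDl 1 0) -map_comp; do 2!congr cons; congr flatten.
by apply: eq_map => i /=; rewrite add1n nth_behead size_behead ltn_predRL.
Qed.

Lemma decode_code K z : decode (code K z) = take K z.
Proof.
elim: K z => [|K IH] z; first by rewrite take0.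
rewrite codeS; case: z => [|b z] /=; rewrite IH //; by case: K {IH}.
Qed.

Lemma code_inj K z z' : code K z = code K z' -> take K z = take K z'.
Proof. by move=> h; rewrite -!decode_code h. Qed.

(** The first bit tells whether the symbol is a bit, the second which one, as in the pairs of
    [code]. [Blank] is the pair obtained by default past the end of an encoding. *)
Definition symb (s : sym) : seq bool :=
  match s with
  | Blank => [:: false; false] | Sep => [:: false; true]
  | Zero => [:: true; false] | One => [:: true; true]
  end.

Definition bsym (b1 b2 : bool) : sym :=
  if b1 then if b2 then One else Zero else if b2 then Sep else Blank.

Lemma size_symb s : size (symb s) = 2. Proof. by case: s. Qed.

Lemma symbK s : bsym (nth false (symb s) 0) (nth false (symb s) 1) = s.
Proof. by case: s. Qed.

Definition rdsym (x : seq bool) k := bsym (nth false x k) (nth false x k.+1).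

Lemma syms_out_size s i :
  (i < size (syms_out s)) = all (fun j => nth false (symb (nth Blank s j)) 0) (iota 0 i.+1).
Proof.
elim: s i => [|a s IH] i //.
case: a; rewrite //= ltnS; case: i => [|i] //; rewrite (iotaDl 1 0) all_map IH;
  by apply: eq_all => j.
Qed.

Lemma syms_out_nth s i : i < size (syms_out s) ->
  nth false (syms_out s) i = nth false (symb (nth Blank s i)) 1.
Proof. by elim: s i => [|[] s IH] [|i] //=; rewrite ?ltnS => /IH. Qed.

Section Simulation.
Variable M : TM.
Local Notation Q := 'I_(tm_n M).+1.
Let H := (tm_n M).+1 + 2.

Definition qbits (q : Q) : seq bool := [seq i == q :> nat | i <- iota 0 (tm_n M).+1].

Definition rdq (x : seq bool) : Q :=
  inord (index true [seq nth false x i | i <- iota 2 (tm_n M).+1]).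

Definition hbits (q : Q) (h : sym) := symb h ++ qbits q.

(* The left and right halves of the tape are interleaved, so that every cell of
   the encoding of the next configuration depends on the header and on three
   adjacent cells only, and reading past the end of the encoding gives blanks. *)
Definition cbits T (c : config M) : seq bool :=
  let: (q, l, h, r) := c in
  hbits q h ++
  flatten [seq symb (nth Blank l i) ++ symb (nth Blank r i) | i <- iota 0 T].

Lemma size_hbits q h : size (hbits q h) = H.
Proof. by rewrite size_cat size_symb size_map size_iota addnC. Qed.

Lemma size_cells (f g : nat -> sym) T :
  size (flatten [seq symb (f i) ++ symb (g i) | i <- iota 0 T]) = T * 4.
Proof.
by rewrite (@size_flatten_const _ _ 4) ?size_iota // => i _; rewrite size_cat !size_symb.
Qed.

Lemma size_cbits T c : size (cbits T c) = H + T * 4.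
Proof. by case: c => [[[q l] h] r]; rewrite size_cat size_hbits size_cells. Qed.

Lemma rdq_cbits T q l h r : rdq (cbits T (q, l, h, r)) = q.
Proof.
rewrite /rdq; have -> : [seq nth false (cbits T (q, l, h, r)) i | i <- iota 2 (tm_n M).+1] = qbits q.
  apply: (@eq_from_nth _ false); rewrite !size_map !size_iota // => i hi.
  rewrite (nth_map 0) ?size_iota // nth_iota // /cbits /hbits -catA nth_cat size_symb addKn.
  rewrite (_ : 2 + i < 2 = false); last by lia.
  rewrite nth_cat.
  by rewrite size_map size_iota hi.
have hq : true \in qbits q by apply/mapP; exists (q : nat); rewrite ?mem_iota ?eqxx //= add0n.
have hi : index true (qbits q) < (tm_n M).+1.
  by move: hq; rewrite -index_mem size_map size_iota.
apply/val_inj; rewrite /= inordK //.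
have := nth_index false hq; rewrite (nth_map 0) ?size_iota // nth_iota // add0n.
by move/eqP.
Qed.

Lemma rdsym_head T q l h r : rdsym (cbits T (q, l, h, r)) 0 = h.
Proof. by case: h. Qed.

Lemma rd_cell T q l h r i k : size l <= T -> size r <= T -> k < 4 ->
  nth false (cbits T (q, l, h, r)) (H + i * 4 + k) =
  nth false (symb (nth Blank l i) ++ symb (nth Blank r i)) k.
Proof.
move=> hl hr hk; rewrite /cbits nth_cat size_hbits -addnA ltnNge leq_addr /= addKn.
case: (ltnP i T) => hi.
  rewrite (@nth_flatten_const _ _ 0) ?size_iota ?nth_iota // => a.
  by rewrite size_cat !size_symb.
rewrite nth_default; last by rewrite size_cells; lia.
rewrite (nth_default _ (leq_trans hl hi)) (nth_default _ (leq_trans hr hi)).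
by move: k hk; do 4!case=> //.
Qed.

Lemma rdsym_left T q l h r i : size l <= T -> size r <= T ->
  rdsym (cbits T (q, l, h, r)) (H + i * 4) = nth Blank l i.
Proof.
move=> hl hr; have h0 := rd_cell q h i hl hr (isT : 0 < 4).
have h1 := rd_cell q h i hl hr (isT : 1 < 4).
rewrite addn0 in h0; rewrite addn1 in h1.
by rewrite /rdsym h0 h1 !nth_cat !size_symb symbK.
Qed.

Lemma rdsym_right T q l h r i : size l <= T -> size r <= T ->
  rdsym (cbits T (q, l, h, r)) (H + i * 4 + 2) = nth Blank r i.
Proof.
move=> hl hr; have h0 := rd_cell q h i hl hr (isT : 2 < 4).
have h1 := rd_cell q h i hl hr (isT : 3 < 4).
rewrite (addnS _ 2) in h1.
by rewrite /rdsym h0 h1 !nth_cat !size_symb symbK.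
Qed.

Definition next_head (x : seq bool) : seq bool :=
  let q := rdq x in let h := rdsym x 0 in
  if tm_halt q then hbits q h else
  let: (q', s, m) := tm_delta q h in
  hbits q' (match m with
            | MStay => s
            | MLeft => rdsym x (H + 0 * 4)
            | MRight => rdsym x (H + 0 * 4 + 2)
            end).

Definition next_cell i (x : seq bool) : seq bool :=
  let q := rdq x in let h := rdsym x 0 in
  let cl j := rdsym x (H + j * 4) in let cr j := rdsym x (H + j * 4 + 2) in
  let: (s, m) := if tm_halt q then (Blank, MStay) else
                 let: (q', s, m) := tm_delta q h in (s, m) in
  match m with
  | MStay => symb (cl i) ++ symb (cr i)
  | MLeft => symb (cl i.+1) ++ symb (if i is j.+1 then cr j else s)
  | MRight => symb (if i is j.+1 then cl j else s) ++ symb (cr i.+1)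
  end.

Definition next_bits T (x : seq bool) : seq bool :=
  next_head x ++ flatten [seq next_cell i x | i <- iota 0 T].

Definition fits T (c : config M) := let: (q, l, h, r) := c in (size l <= T) && (size r <= T).

(** Only the old configuration has to fit: the new cells below [T] depend on old cells up to index
    [T], and the one at [T] is blank and also reads as blank. *)
Lemma cbits_step T c : fits T c -> cbits T (tm_step c) = next_bits T (cbits T c).
Proof.
case: c => [[[q l] h] r] /andP[hl hr].
rewrite /next_bits /next_head /next_cell rdq_cbits rdsym_head.
rewrite (rdsym_left _ _ _ hl hr) (rdsym_right _ _ _ hl hr).
rewrite [tm_step _]/=; case: (tm_halt q).
  congr (_ ++ flatten _); apply: eq_map => i.
  by rewrite rdsym_left ?rdsym_right.
case: (tm_delta q h) => [[q' s] []].
- case: l hl => [|a l] hl; congr (_ ++ flatten _); apply: eq_map => -[|i] /=;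
  by rewrite ?rdsym_left ?rdsym_right ?nth_nil.
- case: r hr => [|a r] hr; congr (_ ++ flatten _); apply: eq_map => -[|i] /=;
  by rewrite ?rdsym_left ?rdsym_right ?nth_nil.
congr (_ ++ flatten _); apply: eq_map => i.
by rewrite rdsym_left ?rdsym_right.
Qed.

Lemma fits_step T c : fits T c -> fits T.+1 (tm_step c).
Proof.
case: c => [[[q l] h] r] /andP[hl hr] /=; case: (tm_halt q) => /=; first lia.
case: (tm_delta q h) => [[q' s] []] /=; last lia.
  case: l hl => [|a l] /=; lia.
by case: r hr => [|a r] /=; lia.
Qed.

Lemma fits_le T T' c : T <= T' -> fits T c -> fits T' c.
Proof. by case: c => [[[q l] h] r] hT /andP[hl hr] /=; lia. Qed.

Lemma fits_run w t : fits (size w + t) (tm_run M w t).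
Proof.
elim: t => [|t IH]; first by rewrite /= size_behead; lia.
by rewrite addnS /tm_run iterS; apply: fits_step.
Qed.

Lemma cbits_run w t T : size w + t <= T ->
  cbits T (tm_run M w t) = iter t (next_bits T) (cbits T (tm_init M w)).
Proof.
elim: t => [//|t IH] hT; rewrite [LHS]/= cbits_step; last first.
  by apply: fits_le (fits_run w t); lia.
by rewrite [RHS]/= -IH //; lia.
Qed.

Lemma size_next_cell i x : size (next_cell i x) = 4.
Proof.
rewrite /next_cell; case: (if _ then _ else _) => s [];
by rewrite size_cat !size_symb.
Qed.

Lemma size_next_head x : size (next_head x) = H.
Proof.
rewrite /next_head; case: ifP => _; first exact: size_hbits.
by case: (tm_delta _ _) => [[q s] m]; apply: size_hbits.
Qed.

Lemma size_next_bits T x : size (next_bits T x) = H + T * 4.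
Proof.
rewrite size_cat size_next_head (@size_flatten_const _ _ 4) ?size_iota // => i _.
exact: size_next_cell.
Qed.

Lemma rdsym_dep (r : seq nat) x y k : {in r, forall i, nth false x i = nth false y i} ->
  k \in r -> k.+1 \in r -> rdsym x k = rdsym y k.
Proof. by move=> h h1 h2; rewrite /rdsym !h. Qed.

Lemma rdq_dep (r : seq nat) x y : {in r, forall i, nth false x i = nth false y i} ->
  {subset iota 0 H <= r} -> rdq x = rdq y.
Proof.
move=> h hs; rewrite /rdq; congr (inord (index _ _)); apply/eq_in_map => i hi.
by apply/h/hs; move: hi; rewrite !mem_iota /H; lia.
Qed.

Lemma cc_next_bits : exists s, forall I T, cc I (s * T.+1) (next_bits T).
Proof.
(* The header and the cells [i.-1], [i] and [i.+1]. For [i = 0] the first cell is listed twice, so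
   that all these lists have the same length and one size bound serves them. *)
pose dep i := iota 0 H ++ iota (H + i.-1 * 4) 4 ++ iota (H + i * 4) 4 ++ iota (H + i.+1 * 4) 4.
have [s1 h1] := cc_dep (size (dep 0)) H.
have [s2 h2] := cc_dep (size (dep 0)) 4.
have mdep i j k : k < 4 -> (i.-1 <= j <= i.+1) -> H + j * 4 + k \in dep i.
  by rewrite !mem_cat !mem_iota; lia.
have ldep i x y j : {in dep i, forall i, nth false x i = nth false y i} ->
    (i.-1 <= j <= i.+1) -> rdsym x (H + j * 4) = rdsym y (H + j * 4).
  move=> e hj; apply: (rdsym_dep e).
    by have := mdep i j 0 isT hj; rewrite addn0.
  by have := mdep i j 1 isT hj; rewrite addn1.
have rdep i x y j : {in dep i, forall i, nth false x i = nth false y i} ->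
    (i.-1 <= j <= i.+1) -> rdsym x (H + j * 4 + 2) = rdsym y (H + j * 4 + 2).
  move=> e hj; apply: (rdsym_dep e); first exact: mdep.
  by have := mdep i j 3 isT hj; rewrite (addnS _ 2).
have sdep i : {subset iota 0 H <= dep i} by move=> k; rewrite !mem_cat => ->.
have hdep i k : k < 2 -> k \in dep i.
  by move=> hk; apply: sdep; rewrite mem_iota /H; lia.
exists (s1 + s2) => I T; rewrite mulnDl; apply: cc_cat.
  apply: (cc_le (_ : s1 <= _)); first by rewrite leq_pmulr.
  apply: (h1 _ (dep 0)) => // [x _|x y _ _ e]; first exact: size_next_head.
  rewrite /next_head (rdq_dep e (sdep 0)) (ldep _ _ _ _ e) // (rdep _ _ _ _ e) //.
  by rewrite (@rdsym_dep (dep 0) x y) ?hdep.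
have := @cc_flatten _ I s2 (iota 0 T) next_cell _.
rewrite size_iota => h; apply: cc_le (h _) => [|i _]; first by rewrite mulnC leq_mul.
apply: (h2 _ (dep i)) => // [|x _|x y _ _ e]; last 2 first.
- exact: size_next_cell.
- have L j := ldep i x y j e; have R j := rdep i x y j e.
  rewrite /next_cell (rdq_dep e (sdep i)) (rdsym_dep e) ?hdep //.
  case: (if _ then _ else _) => s [];
  rewrite ?L ?R //; try lia; by case: (i) L R => [|j] L R //; rewrite ?L ?R //=; lia.
by rewrite !size_cat !size_iota.
Qed.

(* Symbol [i] of an initial tape is either fixed or given by an input bit. *)
Definition tsym (v : seq bool) (a : sym + nat) : sym :=
  match a with inl s => s | inr j => if nth false v j then One else Zero end.

Lemma cc_tsym I a : cc I 4 (fun v => symb (tsym v a)).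
Proof.
case: a => [s|j] /=; first by have := cc_const I (symb s); rewrite size_symb.
by apply: cc_ext (cc_cat (bc_const I true) (bc_in I j)) => v _; case: nth.
Qed.

Lemma nth_tape v ts i : nth Blank [seq tsym v a | a <- ts] i = tsym v (nth (inl Blank) ts i).
Proof.
case: (ltnP i (size ts)) => hi; first by rewrite (nth_map (inl Blank)).
by rewrite !nth_default ?size_map.
Qed.

Lemma cc_init I T ts :
  cc I (H * 4 + T * 8) (fun v => cbits T (tm_init M [seq tsym v a | a <- ts])).
Proof.
apply: cc_ext (cc_le _ (cc_cat (cc_cat (cc_tsym I (nth (inl Blank) ts 0)) (cc_const I (qbits ord0)))
   (@cc_flatten _ I 8 (iota 0 T) (fun i v => symb Blank ++ symb (tsym v (nth (inl Blank) ts i.+1))) _))).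
- move=> v _; rewrite /cbits /tm_init /hbits -nth_tape nth0; congr (_ ++ flatten _).
  by apply: eq_map => i; rewrite nth_nil nth_behead nth_tape.
- by rewrite !size_map !size_iota /H; lia.
by move=> i _; apply: cc_cat (cc_const I (symb Blank)) (cc_tsym _ _).
Qed.

Lemma cc_iter I J s F G t : cc I s G -> (forall x, size x = I -> size (G x) = J) ->
  cc J s F -> (forall x, size x = J -> size (F x) = J) ->
  cc I (s + t * s) (fun x => iter t F (G x)).
Proof.
move=> hG zG hF zF; elim: t => [|t IH]; first by rewrite addn0.
apply: cc_le (cc_comp IH _ hF); first by rewrite mulSn; lia.
by move=> x hx; elim: t {IH} => [|t IHt] /=; [apply: zG | apply: zF].
Qed.

(** The output begins under the head and continues in the right half of the tape, which is the
    second symbol of each interleaved cell. *)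
Definition out_pos i := if i is j.+1 then H + j * 4 + 2 else 0.

Lemma rd_out T q l h r i k : size l <= T -> size r <= T -> k < 2 ->
  nth false (cbits T (q, l, h, r)) (out_pos i + k) = nth false (symb (nth Blank (h :: r) i)) k.
Proof.
move=> hl hr hk; case: i => [|i]; first by rewrite /cbits /hbits -catA nth_cat size_symb add0n hk.
rewrite -addnA rd_cell //.
by rewrite nth_cat size_symb addKn.
Qed.

Lemma cc_output I K : cc I (K * (20 + K * 12)) (fun x =>
  flatten [seq let b := all (fun j => nth false x (out_pos j)) (iota 0 i.+1) in
               [:: b; b && nth false x (out_pos i).+1] | i <- iota 0 K]).
Proof.
rewrite -{1}(size_iota 0 K); apply: cc_flatten => i; rewrite mem_iota /= add0n => hi.
have ha : bc I (2 + i.+1 * 6) (fun x => all (fun j => nth false x (out_pos j)) (iota 0 i.+1)).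
  have := @bc_all _ I 2 (iota 0 i.+1) (fun j x => nth false x (out_pos j)) _.
  by rewrite size_iota; apply=> j _; apply: bc_in.
by apply: cc_le (cc_cat ha (bc_and ha (bc_in I _))); lia.
Qed.

Lemma code_output T c K : fits T c ->
  code K (tm_output c) =
  flatten [seq let b := all (fun j => nth false (cbits T c) (out_pos j)) (iota 0 i.+1) in
               [:: b; b && nth false (cbits T c) (out_pos i).+1] | i <- iota 0 K].
Proof.
case: c => [[[q l] h] r] /andP[hl hr]; congr flatten; apply: eq_map => i.
have -> : all (fun j => nth false (cbits T (q, l, h, r)) (out_pos j)) (iota 0 i.+1) =
          (i < size (syms_out (h :: r))).
  rewrite syms_out_size; apply: eq_all => j.
  by rewrite -[out_pos j]addn0 rd_out.
have h1 := rd_out q h i hl hr (isT : 1 < 2); rewrite addn1 in h1.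
cbv zeta; rewrite h1; congr [:: _; _].
case: ltnP => hi; first by rewrite syms_out_nth.
by rewrite nth_default.
Qed.

Lemma size_output w t : size (tm_output (tm_run M w t)) <= (size w + t).+1.
Proof.
have := fits_run w t; case: (tm_run M w t) => [[[q l] h] r] /= /andP[_ hr].
have hs s : size (syms_out s) <= size s by elim: s => // -[] s /=; rewrite ?ltnS.
by apply: leq_trans (hs (h :: r)) _; rewrite ltnS.
Qed.

(** The exponent depends on the machine alone. The tape is a template of fixed symbols and input
    bits, so that the same circuits serve functions of one string and verifiers of pairs. *)
Lemma cc_tm_run : exists c, forall I ts t K,
  cc I ((size ts + t + K).+2 ^ c)
    (fun v => code K (tm_output (tm_run M [seq tsym v a | a <- ts] t))).
Proof.
have [s hs] := cc_next_bits.
pose B N := (H * 4 + N * 8 + s * N.+1) * N.+1 + N * (20 + N * 12).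
have [c hc] : polyb B.
  by rewrite /B; solve_polyb.
exists c => I ts t K; apply: cc_le (hc _) _.
set N := size ts + t + K; pose T := size ts + t.
have hTN : T <= N by rewrite /N /T; lia.
have hb : cc I ((H * 4 + N * 8 + s * N.+1) * N.+1)
   (fun v => cbits T (tm_run M [seq tsym v a | a <- ts] t)).
  have h1 : cc I (H * 4 + N * 8 + s * N.+1) (fun v => cbits T (tm_init M [seq tsym v a | a <- ts])).
    by apply: cc_le (cc_init I T ts); nia.
  have h2 : cc (H + T * 4) (H * 4 + N * 8 + s * N.+1) (next_bits T).
    by apply: cc_le (hs _ T); nia.
  have h3 := @cc_iter _ _ _ _ _ t h1 _ h2 _.
  apply: cc_ext (cc_le _ (h3 _ _)) => [v _||v _|x _].
  - by rewrite cbits_run // size_map.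
  - have : t <= N by rewrite /N; lia.
    by nia.
  - exact: size_cbits.
  - exact: size_next_bits.
have hK : K <= N by rewrite /N; lia.
apply: cc_ext (cc_le _ (cc_comp hb _ (cc_output (H + T * 4) K))) => [v _||v _].
- rewrite (@code_output T) //.
  by rewrite /T -(size_map (tsym v)); apply: fits_run.
- by rewrite /B; nia.
- exact: size_cbits.
Qed.

End Simulation.

(** * A machine running straight-line programs *)

Section MachineOverFinType.
Variables (Q : finType) (q0 : Q) (delta : Q -> sym -> Q * sym * move) (halt : Q -> bool).

(** Machines start in [ord0], so the start state is moved to the front of the enumeration. *)
Definition state_list := q0 :: rem q0 (enum Q).
Definition state_of (i : 'I_#|Q|.-1.+1) : Q := nth q0 state_list i.
Definition index_of (q : Q) : 'I_#|Q|.-1.+1 := inord (index q state_list).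

Lemma index_ofK : cancel index_of state_of.
Proof.
move=> q; have hp : perm_eq state_list (enum Q).
  by rewrite perm_sym perm_to_rem ?mem_enum.
rewrite /state_of /index_of inordK ?nth_index //; try by rewrite (perm_mem hp) mem_enum.
have := index_mem q state_list; rewrite (perm_mem hp) mem_enum (perm_size hp) -cardE.
by case: #|Q|.
Qed.

Lemma index_of0 : index_of q0 = ord0.
Proof. by apply/val_inj; rewrite /= /index_of /= eqxx inordK. Qed.

Definition fin_TM : TM :=
  {| tm_n := #|Q|.-1;
     tm_delta i s := let: (q, s', m) := delta (state_of i) s in (index_of q, s', m);
     tm_halt i := halt (state_of i) |}.

Definition fconfig := (Q * seq sym * sym * seq sym)%type.

(** The tape is seen from a gap between [l] (reversed) and [t], with the head on the first cell to
    the right of the gap, or to its left for [at_left]. Scanning a block then amounts to moving the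
    gap across it. *)
Definition at_right q l t : fconfig := (q, l, head Blank t, behead t).
Definition at_left q l t : fconfig := (q, behead l, head Blank l, t).

Definition fstep (c : fconfig) : fconfig :=
  let: (q, l, h, r) := c in
  if halt q then c else
  let: (q', s, m) := delta q h in
  match m with
  | MStay => (q', l, s, r)
  | MLeft => at_left q' l (s :: r)
  | MRight => at_right q' (s :: l) r
  end.

Definition to_config (c : fconfig) : config fin_TM :=
  let: (q, l, h, r) := c in (index_of q, l, h, r).

Lemma fstepE c : tm_step (to_config c) = to_config (fstep c).
Proof.
case: c => [[[q l] h] r]; rewrite /= index_ofK; case: (halt q) => //.
case: (delta q h) => [[q' s] []] //=; by [case: l | case: r].
Qed.

Lemma fin_run w t : tm_run fin_TM w t = to_config (iter t fstep (at_right q0 [::] w)).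
Proof.
elim: t => [|t IH]; first by rewrite /= /tm_run /= /tm_init index_of0.
by rewrite /tm_run iterS [iter t _ _]IH fstepE.
Qed.

Definition fhalted (c : fconfig) := halt c.1.1.1.

Lemma to_config_halted c : tm_halted (to_config c) = fhalted c.
Proof. by case: c => [[[q l] h] r]; rewrite /= index_ofK. Qed.

Lemma fhalted_iter c t t' : fhalted (iter t fstep c) -> t <= t' -> iter t' fstep c = iter t fstep c.
Proof.
move=> hc le; rewrite -(subnK le) iterD; elim: (t' - t) => //= n ->.
by move: hc; case: (iter t fstep c) => [[[q l] h] r]; rewrite /fhalted /= => ->.
Qed.

End MachineOverFinType.

(** One cycle fetches and erases an opcode, seeks the separator, acts there and goes back left to
    the first blank. In the [MoveR] and [MoveL] phases the bit that crosses the separator is parked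
    in the first opcode bit, which is free by then. *)
Inductive phase := Fetch0 | Fetch1 | Fetch2 | Seek | MoveR1 | MoveR2 | MoveL1 | MoveL2
  | ReadBit | WriteBit | SkipSep | Back | Answer | Halt.

Definition phase_code p := match p with
  Fetch0 => 0 | Fetch1 => 1 | Fetch2 => 2 | Seek => 3 | MoveR1 => 4 | MoveR2 => 5 | MoveL1 => 6
  | MoveL2 => 7 | ReadBit => 8 | WriteBit => 9 | SkipSep => 10 | Back => 11 | Answer => 12 | Halt => 13 end.

Definition phases := [:: Fetch0; Fetch1; Fetch2; Seek; MoveR1; MoveR2; MoveL1; MoveL2;
  ReadBit; WriteBit; SkipSep; Back; Answer; Halt].

Lemma phase_codeK : cancel phase_code (nth Halt phases). Proof. by case. Qed.

HB.instance Definition _ := Countable.copy phase (can_type phase_codeK).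

Lemma phases_enum : Finite.axiom phases. Proof. by case. Qed.

HB.instance Definition _ := isFinite.Build phase phases_enum.

Definition opcode := (bool * bool * bool)%type.
Definition ustate := (phase * opcode * (bool * bool))%type.

Definition bitof s := match s with Zero => Some false | One => Some true | _ => None end.
Definition symof (b : bool) := if b then One else Zero.

Definition store_val (o : opcode) (a b : bool) : bool :=
  let: (o1, o2, o3) := o in
  if o1 then if o2 then if o3 then a || b else a && b else o3 else ~~ a.

(* The tape is [X Sep Y] where [X] consists of the remaining program, written
   with opcodes of three bits, followed by the part of the memory left of the
   data head; the separator marks the position of the data head. *)
Definition udelta (q : ustate) (s : sym) : ustate * sym * move :=
  let: (p, (o1, o2, o3), (a, b)) := q in
  let go p' s' m := ((p', (o1, o2, o3), (a, b)), s', m) in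
  let reject := go Halt Blank MStay in
  match p, bitof s with
  | Fetch0, Some c => ((Fetch1, (c, o2, o3), (a, b)), Blank, MRight)
  | Fetch0, None => if s is Sep then go Answer Sep MLeft else reject
  | Fetch1, Some c => ((Fetch2, (o1, c, o3), (a, b)), Blank, MRight)
  | Fetch2, Some c => ((Seek, (o1, o2, c), (a, b)), Blank, MRight)
  | Seek, Some _ => go Seek s MRight
  | Seek, None =>
      match o1, o2, o3 with
      | false, false, false => go MoveR1 Sep MRight
      | false, false, true => go MoveL1 Sep MLeft
      | false, true, false => go ReadBit Sep MRight
      | _, _, _ => go WriteBit Sep MRight
      end
  | MoveR1, Some c => ((MoveR2, (c, o2, o3), (a, b)), Sep, MLeft)
  | MoveR2, _ => go Back (symof o1) MLeft
  | MoveL1, Some c => ((MoveL2, (c, o2, o3), (a, b)), Sep, MRight)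
  | MoveL2, _ => go SkipSep (symof o1) MLeft
  | ReadBit, Some c => ((SkipSep, (o1, o2, o3), (c, a)), s, MLeft)
  | WriteBit, Some _ => go SkipSep (symof (store_val (o1, o2, o3) a b)) MLeft
  | SkipSep, _ => go Back s MLeft
  | Back, Some _ => go Back s MLeft
  | Back, None => go Fetch0 Blank MRight
  | Answer, _ => go Halt (if a then One else Blank) MStay
  | _, _ => reject
  end.

Definition uhalt (q : ustate) := q.1.1 == Halt.
Definition ustart : ustate := (Fetch0, (false, false, false), (false, false)).
Definition uTM := fin_TM ustart udelta uhalt.
Local Notation ustep := (fstep udelta uhalt).

(** Program and left memory share the first string with no mark between them. A program must
    therefore bring the data head back to the left end, so that this string is empty when the
    program is over. The two registers hold the last bit read and the one before. *)
Definition mstate := (seq bool * seq bool * bool * bool)%type.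

Definition mop (o : opcode) (X Y : seq bool) (a b : bool) : option mstate :=
  match o with
  | (false, false, false) => if Y is c :: Y' then Some (rcons X c, Y', a, b) else None
  | (false, false, true) =>
      if X is x :: X' then Some (belast x X', last x X' :: Y, a, b) else None
  | (false, true, false) => if Y is c :: _ then Some (X, Y, c, a) else None
  | _ => if Y is c :: Y' then Some (X, store_val o a b :: Y', a, b) else None
  end.

Definition mstep (s : mstate) : option mstate :=
  let: (X, Y, a, b) := s in
  if X is o1 :: o2 :: o3 :: X' then mop (o1, o2, o3) X' Y a b else None.

Definition mconfig k o (s : mstate) : fconfig ustate :=
  let: (X, Y, a, b) := s in
  at_right (Fetch0, o, (a, b)) (nseq k Blank) (enc X ++ Sep :: enc Y).

Lemma enc_cat X Y : enc (X ++ Y) = enc X ++ enc Y. Proof. exact: map_cat. Qed.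
Lemma seek_right o ab X l t :
  iter (size X) ustep (at_right (Seek, o, ab) l (enc X ++ t)) =
  at_right (Seek, o, ab) (enc (rev X) ++ l) t.
Proof.
case: o => [[o1 o2] o3]; case: ab => a b.
elim: X l => [|x X IH] l //; rewrite iterSr rev_cons -cats1 enc_cat -catA -IH.
by congr iter; case: x.
Qed.

Lemma back_left o ab X l t :
  iter (size X) ustep (at_left (Back, o, ab) (enc (rev X) ++ l) t) =
  at_left (Back, o, ab) l (enc X ++ t).
Proof.
case: o => [[o1 o2] o3]; case: ab => a b.
elim/last_ind: X t => [|X x IH] t //.
rewrite size_rcons iterSr -cats1 enc_cat -catA -IH rev_cat.
by congr iter; case: x.
Qed.

Lemma back_to_fetch k o a b X t :
  iter (size X).+1 ustep (at_left (Back, o, (a, b)) (enc (rev X) ++ nseq k Blank) t) =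
  at_right (Fetch0, o, (a, b)) (nseq k.-1.+1 Blank) (enc X ++ t).
Proof. by rewrite iterS back_left; case: o => [[o1 o2] o3]; case: k. Qed.

(** A cycle crosses the part left of the separator twice. The number of erased cells and the stale
    opcode do not influence later cycles, so they are left existential. *)
Lemma mstep_sim k o s : exists t k' o', t <= 2 * size s.1.1.1 + 10 /\
  match mstep s with
  | Some s' => iter t ustep (mconfig k o s) = mconfig k' o' s'
  | None => fhalted uhalt (iter t ustep (mconfig k o s))
  end.
Proof.
case: s => [[[X Y] a] b]; case: o => [[p1 p2] p3].
case: X => [|o1 [|o2 [|o3 X]]].
- by exists 2, 0, (p1, p2, p3).
- by exists 2, 0, (p1, p2, p3); split=> //; case: o1.
- by exists 3, 0, (p1, p2, p3); split=> //; case: o1; case: o2.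
pose B := nseq k.+3 Blank.
have fetch : iter (size X + 3) ustep (mconfig k (p1, p2, p3) ([:: o1, o2, o3 & X], Y, a, b)) =
    at_right (Seek, (o1, o2, o3), (a, b)) (enc (rev X) ++ B) (Sep :: enc Y).
  by rewrite iterD -seek_right; congr iter; case: o1; case: o2; case: o3.
have back o t : iter (size X).+1 ustep (at_left (Back, o, (a, b)) (enc (rev X) ++ B) t) =
    at_right (Fetch0, o, (a, b)) B (enc X ++ t) by rewrite back_to_fetch.
rewrite /mstep /mop.
have skip o a' b' t :
    iter (size X).+2 ustep (at_left (SkipSep, o, (a', b')) (Sep :: enc (rev X) ++ B) t) =
    at_right (Fetch0, o, (a', b')) B (enc X ++ Sep :: t).
  rewrite iterSr; apply: etrans (back_to_fetch k.+3 o a' b' X (Sep :: t)).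
  by case: o => [[? ?] ?].
have store : exists t k' o', t <= 2 * size (o1 :: o2 :: o3 :: X) + 10 /\
  ((o1, o2, o3) \notin [:: (false, false, false); (false, false, true); (false, true, false)] ->
  match (if Y is c :: Y' then Some (X, store_val (o1, o2, o3) a b :: Y', a, b) else None) with
  | Some s' => iter t ustep (mconfig k (p1, p2, p3) ([:: o1, o2, o3 & X], Y, a, b)) = mconfig k' o' s'
  | None => fhalted uhalt (iter t ustep (mconfig k (p1, p2, p3) ([:: o1, o2, o3 & X], Y, a, b)))
  end).
  case: Y fetch => [|c Y] fetch.
    exists (2 + (size X + 3)), 0, (p1, p2, p3); split; first by rewrite /=; lia.
    by rewrite iterD fetch; case: o1 {fetch}; case: o2; case: o3.
  exists ((size X).+2 + (2 + (size X + 3))), k.+3, (o1, o2, o3); split; first by rewrite /=; lia.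
  rewrite iterD (iterD 2) fetch => ho.
  rewrite -[RHS]skip; congr iter; by case: o1 {fetch} ho; case: o2; case: o3; case: c.
case: o1 fetch store => fetch store.
  have [t [k' [o' [ht hs]]]] := store; exists t, k', o'; split=> //.
  by apply: hs; case: (o2); case: (o3).
case: o2 fetch store => fetch store; case: o3 fetch store => fetch store.
- by have [t [k' [o' [ht hs]]]] := store; exists t, k', o'; split=> //; apply: hs.
- clear store; case: Y fetch => [|c Y] fetch.
    exists (2 + (size X + 3)), 0, (p1, p2, p3); split; first by rewrite /=; lia.
    by rewrite iterD fetch.
  exists ((size X).+2 + (2 + (size X + 3))), k.+3, (false, true, false).
  split; first by rewrite /=; lia.
  rewrite iterD (iterD 2) fetch -[RHS]skip; congr iter; by case: c {fetch}.
- clear store; case/lastP: X fetch back skip => [|X c] fetch back skip.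
    exists (2 + (0 + 3)), 0, (p1, p2, p3); split; first by rewrite /=; lia.
    by rewrite iterD fetch.
  exists ((size X).+2 + (3 + (size (rcons X c) + 3))), k.+3, (c, false, true).
  split; first by rewrite /= size_rcons; lia.
  rewrite iterD (iterD 3) fetch.
  have -> : (if rcons X c is x :: X' then Some (belast x X', last x X' :: Y, a, b) else None) =
    Some (X, c :: Y, a, b) by case: (X) => //= x X'; rewrite belast_rcons last_rcons.
  rewrite rev_rcons iterSr.
  apply: etrans (back_to_fetch k.+3 (c, false, true) a b X (Sep :: enc (c :: Y))).
  by congr iter; case: c {fetch back skip}.
clear store; case: Y fetch => [|c Y] fetch.
  exists (2 + (size X + 3)), 0, (p1, p2, p3); split; first by rewrite /=; lia.
  by rewrite iterD fetch.
exists ((size X).+1 + (3 + (size X + 3))), k.+3, (c, false, false).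
split; first by rewrite /=; lia.
rewrite iterD (iterD 3) fetch /mconfig -cats1 enc_cat -catA -[RHS]back; congr iter; by case: c {fetch}.
Qed.

Lemma size_mstep s s' : mstep s = Some s' ->
  size s'.1.1.1 < size s.1.1.1 /\
  size s'.1.1.1 + size s'.1.1.2 <= size s.1.1.1 + size s.1.1.2.
Proof.
case: s => [[[X Y] a] b]; case: X => [|o1 [|o2 [|o3 X]]] //=.
case: o1; case: o2; case: o3; case: Y => [|c Y] //=; case: X => [|x X] //= [<-] /=;
rewrite ?size_belast ?size_rcons; lia.
Qed.

(** An instruction consumes three bits left of the separator and puts back at most one, so at most
    that many cycles occur, whether or not the program makes sense: a verifier has to halt on all
    inputs. *)
Lemma umachine_halts k o s : exists2 t,
  t <= (size s.1.1.1).+1 * (2 * (size s.1.1.1 + size s.1.1.2) + 10) &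
  fhalted uhalt (iter t ustep (mconfig k o s)).
Proof.
have [n] := ubnP (size s.1.1.1); elim: n k o s => // n IH k o s hn.
have [t [k' [o' [ht]]]] := mstep_sim k o s.
case E: (mstep s) => [s'|] hs; last first.
  by exists t => //; apply: leq_trans ht _; rewrite mulSn; lia.
have [lt le] := size_mstep E.
have [|t' ht' h'] := IH k' o' s'; first by apply: leq_trans lt _; rewrite -ltnS.
exists (t' + t); last by rewrite iterD hs.
apply: (@leq_trans ((size s'.1.1.1).+2 * (2 * (size s.1.1.1 + size s.1.1.2) + 10))).
  rewrite mulSn addnC leq_add //; first lia.
  by apply: leq_trans ht' _; rewrite leq_mul2l /=; lia.
by rewrite leq_mul2r ltnS lt orbT.
Qed.

Lemma utime_bound : exists p, poly_fun p /\ forall n, n.+1 * (2 * (n + n) + 10) <= p n.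
Proof.
apply: (@polyb_poly_fun (fun n => n.+1 * (2 * (n + n) + 10))).
solve_polyb.
Qed.

Definition mreach (s s' : mstate) := exists n, iter n (obind mstep) (Some s) = Some s'.

Lemma mreach_refl s : mreach s s. Proof. by exists 0. Qed.

Lemma mreach_trans s2 s1 s3 : mreach s1 s2 -> mreach s2 s3 -> mreach s1 s3.
Proof. by move=> [n hn] [m hm]; exists (m + n); rewrite iterD hn. Qed.

Lemma mreach_step s s' : mstep s = Some s' -> mreach s s'.
Proof. by move=> h; exists 1; rewrite /= h. Qed.

Lemma mreach_sim k o s s' : mreach s s' ->
  exists t k' o', iter t ustep (mconfig k o s) = mconfig k' o' s'.
Proof.
case=> n; elim: n s' => [|n IH] s'; first by case=> <-; exists 0, k, o.
rewrite iterS; case E: (iter n _ _) => [s1|] //= h.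
have [t [k1 [o1 h1]]] := IH _ E.
have [t' [k' [o' [_ h']]]] := mstep_sim k1 o1 s1; rewrite h in h'.
by exists (t' + t), k', o'; rewrite iterD h1.
Qed.

(** An instance is a program and a witness is its initial memory, of the same length; nondeterminism
    enters only there. The hypothesis says that the program runs to its end with the data head at
    the left end and the answer in the first register. *)
Lemma universal_NP : exists U : language, NP U /\
  forall w (acc : seq bool -> bool),
    (forall u, size u = size w -> exists Y b,
       mreach (w, u, false, false) ([::], Y, acc u, b)) ->
    (U w <-> exists2 u, size u = size w & acc u).
Proof.
have [p [pp hp]] := utime_bound.
pose run w u := tm_run uTM (enc_pair w u) (p (size w)).
have runE w u : run w u = to_config ustart udelta uhalt
    (iter (p (size w)) ustep (mconfig 0 (false, false, false) (w, u, false, false))).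
  exact: fin_run.
have halts w u : size u = size w ->
    fhalted uhalt (iter (p (size w)) ustep (mconfig 0 (false, false, false) (w, u, false, false))).
  move=> hu; have [t ht h] := umachine_halts 0 (false, false, false) (w, u, false, false).
  rewrite (fhalted_iter h) //; apply: leq_trans ht _; rewrite /= hu; exact: hp.
exists (fun w => exists u, size u = size w /\ tm_output (run w u) = [:: true]); split.
  exists uTM, p, id; split=> //; split.
    by exists [:: 0; 1] => n; rewrite !big_ord_recl big_ord0 /= mul0n mul1n add0n addn0.
  split=> [x y hy|x]; last by [].
  by rewrite -/(run x y) runE to_config_halted halts.
move=> w acc hacc.
have out u : size u = size w -> (tm_output (run w u) == [:: true]) = acc u.
  move=> hu; have [Y [b hr]] := hacc u hu.
  have [t [k' [[[o1 o2] o3] ht]]] := mreach_sim 0 (false, false, false) hr.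
  set c0 := mconfig 0 _ _ in ht; have hh := halts w u hu.
  (* Two more steps on the empty program: from [Fetch0] on the separator to [Answer], and from there
     to [Halt]. *)
  have h2 : fhalted uhalt (iter (2 + t) ustep c0) by rewrite iterD ht.
  have e : iter (p (size w)) ustep c0 = iter (2 + t) ustep c0.
    have [le|le] := leqP (p (size w)) (2 + t); first by rewrite (fhalted_iter hh le).
    by rewrite (fhalted_iter h2 (ltnW le)).
  rewrite runE -/c0 e iterD ht.
  by rewrite /= ; case: (acc u); case: k' {ht}.
split=> [[u [hu /eqP]]|[u hu ha]]; first by rewrite out // => ha; exists u.
by exists u; split=> //; apply/eqP; rewrite out.
Qed.

(** * Compiling circuits into programs *)

Inductive wop := WNot | WConst of bool | WAnd | WOr.
Inductive instr := Rd of nat | Wr of wop & nat.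

Definition wbits o := match o with
  | WNot => [:: false; true; true] | WConst b => [:: true; false; b]
  | WAnd => [:: true; true; false] | WOr => [:: true; true; true] end.

Definition weval o (a b : bool) := match o with
  | WNot => ~~ a | WConst c => c | WAnd => a && b | WOr => a || b end.

Definition goR j := flatten (nseq j [:: false; false; false]).
Definition goL j := flatten (nseq j [:: false; false; true]).

(** The data head leaves from cell 0 and returns to it within each instruction: addresses are
    absolute, and no memory is left of the head at the end of the program. *)
Definition ibits i := match i with
  | Rd j => goR j ++ [:: false; true; false] ++ goL j
  | Wr o j => goR j ++ wbits o ++ goL j
  end.

Definition pbits (il : seq instr) := flatten (map ibits il).

Definition istate := (seq bool * bool * bool)%type.

Definition exec (s : istate) i : istate := let: (m, a, b) := s in
  match i with
  | Rd j => (m, nth false m j, a)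
  | Wr o j => (set_nth false m j (weval o a b), a, b)
  end.

Definition addr i := match i with Rd j => j | Wr _ j => j end.

Lemma goR_reach j P m a b : j <= size m ->
  mreach (goR j ++ P, m, a, b) (P ++ take j m, drop j m, a, b).
Proof.
elim: j P m => [|j IH] P m hj; first by rewrite take0 drop0 cats0; apply: mreach_refl.
case: m hj => [//|c m] hj.
apply: mreach_trans (mreach_step (_ : _ = Some (goR j ++ rcons P c, m, a, b))) _.
  by rewrite /= rcons_cat.
by rewrite /= -cat_rcons; apply: IH.
Qed.

Lemma goL_reach d P m a b : mreach (goL (size d) ++ P ++ d, m, a, b) (P, d ++ m, a, b).
Proof.
elim/last_ind: d m => [|d c IH] m; first by rewrite cats0; apply: mreach_refl.
rewrite size_rcons cat_rcons.
apply: mreach_trans (mreach_step (_ : _ = Some (goL (size d) ++ P ++ d, c :: m, a, b))) (IH _).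
rewrite -!rcons_cat /=; case: (goL _ ++ _) => //= x X.
by rewrite belast_rcons last_rcons.
Qed.

Lemma ibits_reach i P m a b : addr i < size m ->
  let: (m', a', b') := exec (m, a, b) i in mreach (ibits i ++ P, m, a, b) (P, m', a', b').
Proof.
have E j : j < size m -> m = take j m ++ nth false m j :: drop j.+1 m.
  by move=> hj; rewrite -drop_nth // cat_take_drop.
have sz j : j < size m -> size (take j m) = j by move=> hj; rewrite size_take hj.
case: i => [j|o j] /= hj.
  rewrite -!catA; apply: mreach_trans (goR_reach _ _ _ (ltnW hj)) _.
  rewrite (drop_nth false hj).
  apply: mreach_trans (mreach_step (_ : _ =
    Some (goL (size (take j m)) ++ P ++ take j m, nth false m j :: drop j.+1 m, nth false m j, a))) _.
    by rewrite sz // /= -!catA.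
  have := goL_reach (take j m) P (nth false m j :: drop j.+1 m) (nth false m j) a.
  by rewrite -(E _ hj).
rewrite -!catA; apply: mreach_trans (goR_reach _ _ _ (ltnW hj)) _.
rewrite (drop_nth false hj).
apply: mreach_trans (mreach_step (_ : _ =
  Some (goL (size (take j m)) ++ P ++ take j m, weval o a b :: drop j.+1 m, a, b))) _.
  by rewrite sz // /= -!catA; case: o => [|[]||].
suff -> : set_nth false m j (weval o a b) = take j m ++ weval o a b :: drop j.+1 m by apply: goL_reach.
by rewrite set_nthE hj; congr (_ ++ _).
Qed.

Lemma pbits_reach il P s : all (fun i => addr i < size s.1.1) il ->
  mreach (pbits il ++ P, s.1.1, s.1.2, s.2)
         (P, (foldl exec s il).1.1, (foldl exec s il).1.2, (foldl exec s il).2).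
Proof.
elim: il s => [|i il IH] [[m a] b]; first by move=> _; apply: mreach_refl.
case/andP=> hi hil; have := ibits_reach (pbits il ++ P) a b hi.
case E: (exec (m, a, b) i) => [[m' a'] b'] h1.
have -> : foldl exec (m, a, b) (i :: il) = foldl exec (m', a', b') il by rewrite -E.
have sm : size m' = size m.
  by case: i E hi {h1} => [j|o j] /= [<- _ _] // hj; rewrite size_set_nth; apply/maxn_idPr.
rewrite [pbits _]/= -catA; apply: mreach_trans h1 _.
by apply: (IH (m', a', b')); rewrite /= sm.
Qed.

(* A gate first clears its own cell, so that references to wires which are not
   earlier can be redirected there. *)
Definition cgate I n (g : gate) : seq instr :=
  let z := Wr (WConst false) (I + n) in
  let ld j := Rd (I + minn j n) in
  match g with
  | GIn j => let r := Rd (if j < I then j else I + n) in [:: z; r; r; Wr WAnd (I + n)]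
  | GConst b => [:: Wr (WConst b) (I + n)]
  | GNot j => [:: z; ld j; Wr WNot (I + n)]
  | GAnd j k => [:: z; ld j; ld k; Wr WAnd (I + n)]
  | GOr j k => [:: z; ld j; ld k; Wr WOr (I + n)]
  end.

Lemma addr_cgate I n g : all (fun i => addr i <= I + n) (cgate I n g).
Proof.
case: g => [j|b|j|j k|j k] /=; rewrite ?leqnn ?leq_add2l ?geq_minr //.
by case: ltnP => h; rewrite ?leqnn // (leq_trans (ltnW h)) ?leq_addr.
Qed.

Lemma set_nth_mid (s : seq bool) c t e n : n = size s ->
  set_nth false (s ++ c :: t) n e = s ++ e :: t.
Proof. by move=> ->; elim: s => //= x s ->. Qed.

(** The memory holds the inputs, the wires computed so far and then arbitrary guessed bits such as
    [c]. Reading a cell twice fills both registers with it, after which [WAnd] copies it. *)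
Lemma exec_cgate x v c t a b g : exists a' b',
  foldl exec (x ++ v ++ c :: t, a, b) (cgate (size x) (size v) g) =
  (x ++ rcons v (gate_val x v g) ++ t, a', b').
Proof.
have sn c' e : set_nth false (x ++ v ++ c' :: t) (size x + size v) e = x ++ v ++ e :: t.
  by rewrite catA set_nth_mid ?size_cat // -catA.
have rd j : nth false (x ++ v ++ false :: t) (size x + minn j (size v)) = nth false v j.
  rewrite nth_cat ltnNge leq_addr /= addKn nth_cat; case: ltnP => h.
    by congr nth; lia.
  have -> : minn j (size v) = size v by lia.
  by rewrite subnn [RHS]nth_default //; lia.
have rdi j : nth false (x ++ v ++ false :: t) (if j < size x then j else size x + size v) =
             nth false x j.
  case: ltnP => h; first by rewrite nth_cat h.
  by rewrite -size_cat catA nth_cat ltnn subnn [RHS]nth_default.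
case: g => [j|b'|j|j k|j k]; rewrite /= ?sn ?rd ?rdi ?sn ?andbb ?cat_rcons.
- by do 2!eexists.
- by do 2!eexists.
- by do 2!eexists.
- by rewrite andbC; do 2!eexists.
by rewrite orbC; do 2!eexists.
Qed.

Definition cgates I gs := flatten [seq cgate I n (nth (GConst false) gs n) | n <- iota 0 (size gs)].

Lemma cgates_rcons I gs g : cgates I (rcons gs g) = cgates I gs ++ cgate I (size gs) g.
Proof.
rewrite /cgates size_rcons -addn1 iotaD map_cat flatten_cat /= cats0 add0n.
rewrite nth_rcons ltnn eqxx; congr (flatten _ ++ _); apply/eq_in_map => n.
by rewrite mem_iota add0n nth_rcons => /= ->.
Qed.

Lemma addr_cgates I gs : all (fun i => addr i < I + size gs) (cgates I gs).
Proof.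
elim/last_ind: gs => // gs g IH; rewrite cgates_rcons all_cat size_rcons.
apply/andP; split; last by apply: sub_all (addr_cgate _ _ _) => i; rewrite addnS.
by apply: sub_all IH => i /ltnW; rewrite addnS.
Qed.

Lemma exec_cgates x gs w a b : size w = size gs -> forall t, exists a' b',
  foldl exec (x ++ w ++ t, a, b) (cgates (size x) gs) = (x ++ wire_vals gs x ++ t, a', b').
Proof.
elim/last_ind: gs w => [|gs g IH] w; first by case: w => // _ t; exists a, b.
case/lastP: w => [|w c]; rewrite !size_rcons // => -[hw] t.
rewrite cgates_rcons foldl_cat cat_rcons.
have [a' [b' ->]] := IH w hw (c :: t).
by rewrite -(size_wire_vals gs x) wire_vals_rcons; apply: exec_cgate.
Qed.

(** The opcode of a constant write contains the constant, so an input bit appears literally in the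
    program text; the length and the rest of the program do not depend on the input. *)
Definition winput j (v : seq bool) := Wr (WConst (nth false v j)) j.

Lemma exec_inputs v m a b : size v <= size m ->
  foldl exec (m, a, b) [seq winput j v | j <- iota 0 (size v)] = (v ++ drop (size v) m, a, b).
Proof.
move=> hv; suff H n : n <= size v ->
    foldl exec (m, a, b) [seq winput j v | j <- iota 0 n] = (take n v ++ drop n m, a, b).
  by rewrite H // take_size.
elim: n => [|n IH] hn; first by rewrite take0 drop0.
rewrite -addn1 iotaD map_cat foldl_cat IH ?(ltnW hn) //= add0n.
rewrite (drop_nth false); last by lia.
rewrite set_nth_mid ?size_takel ?(ltnW hn) // addn1 (take_nth false) //.
by rewrite cat_rcons.
Qed.

Definition compile I (C : circuit) (v : seq bool) : seq instr :=
  nseq (I + size (c_gates C)) (Rd 0) ++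
  [seq winput j v | j <- iota 0 (size v)] ++
  cgates I (c_gates C) ++ [:: Rd (I + head 0 (c_outs C))].

Lemma size_pbits_ge il : 3 * size il <= size (pbits il).
Proof.
elim: il => //= i il IH; rewrite mulnS size_cat leq_add //.
by case: i => [j|[|?||] j]; rewrite /= !size_cat /=; lia.
Qed.

Lemma size_goR j : size (goR j) = j * 3.
Proof. by elim: j => //= j ->; rewrite mulSn. Qed.

Lemma size_goL j : size (goL j) = j * 3.
Proof. by elim: j => //= j ->; rewrite mulSn. Qed.

Lemma size_ibits i : size (ibits i) = (addr i).*2.+1 * 3.
Proof. by case: i => [j|[|?||] j]; rewrite /= !size_cat size_goR /= size_goL; lia. Qed.

Lemma size_pbits_le il V : all (fun i => addr i < V) il -> size (pbits il) <= size il * (V * 6).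
Proof.
elim: il => //= i il IH /andP[hi /IH h]; rewrite mulSn size_cat size_ibits leq_add //; lia.
Qed.

Lemma size_cgates I gs : size (cgates I gs) <= size gs * 4.
Proof.
elim/last_ind: gs => // gs g IH; rewrite cgates_rcons size_cat size_rcons mulSn addnC leq_add //.
by case: g.
Qed.

Section Compile.
Variables (i k : nat) (C : circuit).
Hypotheses (wfC : cwf C) (outC : 0 < size (c_outs C)).
Let V := i + k + size (c_gates C).

Lemma out_lt : head 0 (c_outs C) < size (c_gates C).
Proof. by move: wfC outC; rewrite /cwf; case: (c_outs C) => //= o os /andP[]. Qed.

Lemma addr_compile v : size v = i -> all (fun j => addr j < V) (compile (i + k) C v).
Proof.
move=> hv; rewrite /compile !all_cat /= andbT; apply/and4P; split.
- have := out_lt; rewrite all_nseq /V /=; lia.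
- rewrite all_map; apply/allP => j; rewrite mem_iota /= /V; lia.
- exact: addr_cgates.
- by rewrite /V ltn_add2l out_lt.
Qed.

Lemma compile_run v u (w : seq bool) : size v = i -> size w = size (pbits (compile (i + k) C v)) ->
  u = take k (drop i w) ->
  exists Y b, mreach (pbits (compile (i + k) C v), w, false, false)
    ([::], Y, nth false (ceval C (v ++ u)) 0, b).
Proof.
move=> hv hw hu.
have hV : V < size w.
  rewrite hw; apply: leq_trans (size_pbits_ge _); rewrite !size_cat size_nseq /=; lia.
have szu : size u = k by rewrite hu size_takel // size_drop; move: hV; rewrite /V; lia.
have := @pbits_reach (compile (i + k) C v) [::] (w, false, false) _.
rewrite cats0 => h.
have {}h := h (sub_all (fun j hj => ltn_trans hj hV) (addr_compile hv)).
suff [b E] : exists b, foldl exec (w, false, false) (compile (i + k) C v) =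
    ((foldl exec (w, false, false) (compile (i + k) C v)).1.1, nth false (ceval C (v ++ u)) 0, b).
  by move: h; rewrite E /= => h; do 2!eexists; apply: h.
have pad n a b : exists a' b', foldl exec (w, a, b) (nseq n (Rd 0)) = (w, a', b').
  by elim: n a b => [|n IH] a b; [exists a, b | apply: IH].
rewrite /compile !foldl_cat.
have [a1 [b1 ->]] := pad (i + k + size (c_gates C)) false false.
rewrite exec_inputs hv; last by move: hV; rewrite /V; lia.
have -> : v ++ drop i w = (v ++ u) ++ take (size (c_gates C)) (drop (i + k) w) ++ drop V w.
  rewrite -catA hu /V.
  rewrite (_ : drop (i + k + size (c_gates C)) w =
               drop (size (c_gates C)) (drop k (drop i w))); last first.
    by rewrite !drop_drop; congr drop; lia.
  rewrite (_ : drop (i + k) w = drop k (drop i w)); last by rewrite drop_drop addnC.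
  by rewrite !cat_take_drop.
have szI : size (v ++ u) = i + k by rewrite size_cat hv szu.
have [|a2 [b2]] := @exec_cgates (v ++ u) (c_gates C)
  (take (size (c_gates C)) (drop (i + k) w)) a1 b1 _ (drop V w).
  by rewrite size_takel // size_drop; move: hV; rewrite /V; lia.
rewrite szI => ->.
exists a2; rewrite /=; congr (_, _, _).
rewrite nth_cat szI ltnNge leq_addr /= addKn nth_cat size_wire_vals out_lt.
by rewrite /ceval; move: outC; case: (c_outs C).
Qed.
End Compile.

Lemma cc_winput I j : cc I (size (ibits (Wr (WConst false) j)) * 2) (fun v => ibits (winput j v)).
Proof.
have h := cc_cat (cc_const I (goR j)) (cc_cat (cc_const I [:: true; false])
   (cc_cat (bc_in I j) (cc_const I (goL j)))).
by apply: cc_ext (cc_le _ h) => //; rewrite /= !size_cat /=; lia.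
Qed.

Lemma pbits_cat s t : pbits (s ++ t) = pbits s ++ pbits t.
Proof. by rewrite /pbits map_cat flatten_cat. Qed.

Lemma cc_compile i k C : cc i ((i + (i + k + size (c_gates C)) + size (c_gates C) * 4 + 1) *
    ((i + k + size (c_gates C) + head 0 (c_outs C)).+1 * 6) * 2) (fun v => pbits (compile (i + k) C v)).
Proof.
set G := size (c_gates C); set o := head 0 _; set V := (i + k + G + o).+1.
have hp il : all (fun i => addr i < V) il -> cc i (size il * (V * 6) * 2) (fun=> pbits il).
  by move=> h; apply: cc_le (cc_const i _); rewrite leq_mul2r size_pbits_le.
have h1 : cc i ((i + k + G) * (V * 6) * 2) (fun=> pbits (nseq (i + k + G) (Rd 0))).
  by have := hp (nseq (i + k + G) (Rd 0)); rewrite size_nseq all_nseq orbT; apply.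
have h2 : cc i (i * (V * 6) * 2) (fun v => pbits [seq winput j v | j <- iota 0 i]).
  have := @cc_flatten _ i (V * 6 * 2) (iota 0 i) (fun j v => ibits (winput j v)) _.
  rewrite size_iota mulnA => h; apply: cc_ext (h _) => [v _|j].
    by rewrite /pbits -map_comp.
  rewrite mem_iota /= => hj; apply: cc_le (cc_winput i j).
  by rewrite leq_mul2r size_ibits /= /V; lia.
have h3 : cc i (G * 4 * (V * 6) * 2) (fun=> pbits (cgates (i + k) (c_gates C))).
  apply: cc_le (hp _ _); first by rewrite !leq_mul2r size_cgates !orbT.
  by apply: sub_all (addr_cgates _ _) => j; rewrite /V /G; lia.
have h4 : cc i (1 * (V * 6) * 2) (fun=> pbits [:: Rd (i + k + o)]).
  by apply: (hp [:: Rd (i + k + o)]); rewrite /= /V; lia.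
apply: cc_ext (cc_le _ (cc_cat h1 (cc_cat h2 (cc_cat h3 h4)))) => [v hv|].
  by rewrite /compile hv !pbits_cat.
by rewrite -!mulnDl; apply: leq_mul => //; apply: leq_mul => //; lia.
Qed.

(** The length of [prog v] must not depend on [v]: a reduction from [U] is later replaced by its
    circuit for this one length. *)
Lemma circuit_problem : exists U : language, NP U /\ exists c, forall i k s D,
  bc (i + k) s D -> exists prog len,
  [/\ len <= (i + k + s).+2 ^ c, cc i ((i + k + s).+2 ^ c) prog &
   forall v, size v = i -> size (prog v) = len /\ (U (prog v) <-> exists2 u, size u = k & D (v ++ u))].
Proof.
have [U [NPU hU]] := universal_NP; exists U; split=> //.
pose B N := (N + N + N * 4 + 1) * ((N + N).+1 * 6) * 2.
have [c hc] : polyb B.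
  by rewrite /B; solve_polyb.
exists c => i k s D [C [wf sz hD]].
have outC : 0 < size (c_outs C).
  have := congr1 size (hD (nseq (i + k) false) _); rewrite size_nseq size_map => ->; by [].
have hG : size (c_gates C) <= s by apply: leq_trans sz; rewrite leq_addr.
have ho := out_lt wf outC.
have len0 v : size v = i ->
    size (pbits (compile (i + k) C v)) = size (pbits (compile (i + k) C (nseq i false))).
  move=> hv; rewrite /compile !pbits_cat !size_cat hv size_nseq; congr (_ + (_ + _)).
  by elim: (iota 0 i) => //= j r; rewrite !size_cat => ->.
exists (fun v => pbits (compile (i + k) C v)), (size (pbits (compile (i + k) C (nseq i false)))); split.
- apply: leq_trans (size_pbits_le (addr_compile k wf outC (size_nseq i false))) _.
  apply: leq_trans (hc _); rewrite /compile !size_cat !size_nseq size_map size_iota /=.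
  have := size_cgates (i + k) (c_gates C); rewrite /B => h.
  apply: leq_trans (leq_pmulr _ _) => //; apply: leq_mul; lia.
- apply: cc_le (cc_compile i k C); apply: leq_trans (hc _); rewrite /B leq_mul2r /=.
  by apply: leq_mul; lia.
move=> v hv; split; first exact: len0.
rewrite (hU _ (fun w => D (v ++ take k (drop i w)))); last first.
  move=> w hw; have [Y [b h]] := compile_run wf outC hv hw (erefl _).
  exists Y, b; move: h; rewrite hD //.
  rewrite size_cat hv size_takel // size_drop hw.
  have := size_pbits_ge (compile (i + k) C v); rewrite /compile !size_cat size_nseq; lia.
have szW : i + k <= size (pbits (compile (i + k) C v)).
  have := size_pbits_ge (compile (i + k) C v); rewrite /compile !size_cat size_nseq; lia.
split=> [[w hw hd]|[u hu hd]].
  exists (take k (drop i w)) => //; rewrite size_takel // size_drop hw; lia.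
exists (nseq i false ++ u ++ nseq (size (pbits (compile (i + k) C v)) - (i + k)) false).
  rewrite !size_cat !size_nseq hu; lia.
by rewrite drop_size_cat ?size_nseq // take_size_cat.
Qed.

(** * The counting argument *)

Section Dichotomy.
Variables (X Y Z : finType) (k : nat).
Hypothesis card_Z : #|Z| <= 2 ^ k.
Local Notation tup := {ffun 'I_k.+1 -> X}.
Variable out : tup -> Y -> option Z.

Definition tuples (S : {set X}) : {set tup} := [set xs | xs \in ffun_on (mem S)].

Lemma card_tuples (S : {set X}) : #|tuples S| = #|S| ^ k.+1.
Proof. by rewrite cardsE card_ffun_on card_ord. Qed.

Lemma tuplesP (S : {set X}) (xs : tup) : reflect (forall i, xs i \in S) (xs \in tuples S).
Proof. by rewrite inE; apply: ffun_onP. Qed.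

(** Each chosen tuple settles at least half of the remaining elements of [Y0], so [e] choices
    suffice. *)
Lemma greedy_cover (S : {set X}) (Y0 : {set Y}) e :
  (forall Y' : {set Y}, Y' \subset Y0 -> Y' != set0 -> exists2 xs, xs \in tuples S &
     #|Y'| <= 2 * #|[set y in Y' | out xs y == None]|) ->
  #|Y0| < 2 ^ e ->
  exists2 r : seq tup, size r <= e & {subset r <= tuples S} /\
    forall y, y \in Y0 -> exists2 xs, xs \in r & out xs y = None.
Proof.
elim: e Y0 => [|e IH] Y0 h.
  rewrite ltnS leqn0 cards_eq0 => /eqP->; exists [::] => //; split=> // y.
  by rewrite inE.
move=> hY; have [->|nY] := eqVneq Y0 set0.
  by exists [::] => //; split=> // y; rewrite inE.
have [xs xsS hxs] := h _ (subxx _) nY.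
set N := [set y in Y0 | out xs y == None] in hxs.
have sN : N \subset Y0 by apply/subsetP => y; rewrite inE => /andP[].
have [||r sr [rS hr]] := IH (Y0 :\: N).
- by move=> Y' sY'; apply: h; apply: subset_trans sY' (subsetDl _ _).
- rewrite cardsD (setIidPr sN); move: hY; rewrite expnS.
  by have := subset_leq_card sN; lia.
exists (xs :: r) => //; split=> [zs|y yY]; first by rewrite inE => /orP[/eqP->|/rS].
have [yN|yN] := boolP (y \in N).
  by exists xs; [rewrite mem_head | move: yN; rewrite inE => /andP[_ /eqP]].
have [|zs zr hz] := hr y; first by rewrite inE yN.
by exists zs; rewrite // inE zr orbT.
Qed.

(** By averaging, some [y] has an output for at least half of the tuples, and by the pigeonhole
    principle one of the at most [2 ^ k] values takes a [2 ^ k]-th part of these. *)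
Lemma popular_output (S : {set X}) (Y' : {set Y}) : S != set0 -> Y' != set0 ->
  (forall xs, xs \in tuples S -> 2 * #|[set y in Y' | out xs y == None]| < #|Y'|) ->
  exists y z, y \in Y' /\ #|tuples S| <= 2 ^ k.+1 * #|[set xs in tuples S | out xs y == Some z]|.
Proof.
move=> nS nY h.
have hP : 0 < #|tuples S| by rewrite card_tuples expn_gt0 card_gt0 nS.
set P := tuples S in h hP *.
have [y yY hy] : exists2 y, y \in Y' & #|P| <= 2 * #|[set xs in P | out xs y != None]|.
  apply/exists_inP; apply: contraT; rewrite negb_exists => /forallP hn.
  have lt y : y \in Y' -> 2 * #|[set xs in P | out xs y != None]| < #|P|.
    by move=> yY; move: (hn y); rewrite yY /= -ltnNge.
  (* The pairs with an output are counted in two ways: per tuple they are more than half of [Y'],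
     per [y] they would be less than half of the tuples. *)
  have dc : \sum_(y in Y') #|[set xs in P | out xs y != None]| =
            \sum_(xs in P) #|[set y in Y' | out xs y != None]|.
    transitivity (\sum_(y in Y') \sum_(xs in P | out xs y != None) 1).
      by apply: eq_bigr => y _; rewrite -sum1dep_card.
    rewrite (exchange_big_dep (mem P)) /=; last by move=> y xs _ /andP[].
    apply: eq_bigr => xs xsP; rewrite -sum1dep_card; apply: eq_bigl => y.
    by rewrite xsP.
  have h1 : \sum_(y in Y') 2 * #|[set xs in P | out xs y != None]| <= #|Y'| * (#|P|.-1).
    rewrite -sum_nat_const; apply: leq_sum => y yY; have := lt _ yY; lia.
  have h2 : #|P| * #|Y'|.+1 <= \sum_(xs in P) 2 * #|[set y in Y' | out xs y != None]|.
    rewrite -sum_nat_const; apply: leq_sum => xs xsP; have := h _ xsP.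
    have <- : #|[set y in Y' | out xs y == None]| + #|[set y in Y' | out xs y != None]| = #|Y'|.
      rewrite -(cardsID [set y | out xs y == None] Y'); congr (_ + _); apply: eq_card => y;
      by rewrite !inE // andbC.
    lia.
  move: h1 h2; rewrite -!big_distrr /= dc => h1 h2; have := leq_trans h2 h1.
  case: #|P| hP => // p _; rewrite mulSn mulnS; lia.
exists y.
have [z hz] : exists z, #|[set xs in P | out xs y != None]| <=
    2 ^ k * #|[set xs in P | out xs y == Some z]|.
  have sumE : #|[set xs in P | out xs y != None]| =
     \sum_(z : Z) #|[set xs in P | out xs y == Some z]|.
    transitivity (\sum_z \sum_(xs in P | out xs y == Some z) 1); last first.
      by apply: eq_bigr => z _; rewrite -sum1dep_card.
    rewrite (exchange_big_dep (mem P)) /=; last by move=> z xs _ /andP[].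
    rewrite -sum1dep_card big_mkcondr; apply: eq_bigr => xs xsP.
    case E: (out xs y) => [z|] /=.
      by rewrite (big_pred1 z) // => z'; rewrite xsP /= (inj_eq Some_inj).
    by rewrite big_pred0 // => z; rewrite andbF.
  (* A maximum over [Z] needs a default element, which an existing output supplies. *)
  have [xs1] : exists xs1, xs1 \in [set xs in P | out xs y != None].
    by apply/card_gt0P; lia.
  rewrite inE; case: (out xs1 y) => [z0|]; rewrite ?andbF // => _.
  pose zm := [arg max_(z > z0) #|[set xs in P | out xs y == Some z]|].
  exists zm; rewrite sumE; apply: (@leq_trans (#|Z| * #|[set xs in P | out xs y == Some zm]|)).
    rewrite -sum_nat_const; apply: leq_sum => z _.
    by rewrite /zm; case: arg_maxnP => // z1 _; apply.
  by rewrite leq_mul2r card_Z orbT.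
exists z; split=> //; apply: leq_trans hy _; rewrite expnS -mulnA leq_mul2l /=.
exact: hz.
Qed.

(** [None] stands for a successful output. Either the tuples over the uncovered part of [S0] admit a
    greedy cover of [Y0], or a popular output covers half of that part; the second case can occur at
    most [d] times. *)
Lemma dichotomy (S0 : {set X}) (Y0 : {set Y}) d e :
  #|S0| < 2 ^ d -> #|Y0| < 2 ^ e ->
  (exists2 r : seq tup, size r <= e & {subset r <= tuples S0} /\
     forall y, y \in Y0 -> exists2 xs, xs \in r & out xs y = None) \/
  (exists2 a : seq (Y * Z), size a <= d &
     (forall p, p \in a -> p.1 \in Y0 /\ exists2 xs, xs \in tuples S0 & out xs p.1 = Some p.2) /\
     forall x, x \in S0 -> exists2 xs, xs \in tuples S0 &
       (exists i, xs i = x) /\ exists2 p, p \in a & out xs p.1 = Some p.2).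
Proof.
move=> hS hY.
(* The uncovered set shrinks to [S], while tuples are still only required to be over [S0]. *)
suff H (S : {set X}) : S \subset S0 -> #|S| < 2 ^ d ->
  (exists2 r : seq tup, size r <= e & {subset r <= tuples S0} /\
     forall y, y \in Y0 -> exists2 xs, xs \in r & out xs y = None) \/
  (exists2 a : seq (Y * Z), size a <= d &
     (forall p, p \in a -> p.1 \in Y0 /\ exists2 xs, xs \in tuples S0 & out xs p.1 = Some p.2) /\
     forall x, x \in S -> exists2 xs, xs \in tuples S0 &
       (exists i, xs i = x) /\ exists2 p, p \in a & out xs p.1 = Some p.2).
  by apply: H.
elim: d S {hS} => [|d IH] S sS hS.
  right; exists [::] => //; split=> // x; move: hS; rewrite ltnS leqn0 cards_eq0 => /eqP->.
  by rewrite inE.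
have sub xs (T : {set X}) : T \subset S0 -> xs \in tuples T -> xs \in tuples S0.
  by move=> sT /tuplesP hx; apply/tuplesP => i; apply: (subsetP sT).
have [S_0|nS] := eqVneq S set0.
  by right; exists [::] => //; split=> // x; rewrite S_0 inE.
case: (boolP [exists Y' : {set Y}, [&& Y' \subset Y0, Y' != set0 &
   [forall xs in tuples S, 2 * #|[set y in Y' | out xs y == None]| < #|Y'|]]]); last first.
  rewrite negb_exists => /forallP hn; left.
  have [|//|r sr [rS hr]] := @greedy_cover S Y0 e.
    move=> Y' sY' nY'; move: (hn Y'); rewrite sY' nY' /= negb_forall_in => /exists_inP[xs xsS].
    by rewrite -leqNgt; exists xs.
  by exists r => //; split=> // xs /rS; apply: sub.
case/existsP => Y' /and3P[sY' nY' /forall_inP hY'].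
have [y [z [yY hz]]] := popular_output nS nY' hY'.
set P := [set xs in tuples S | _] in hz.
(* All entries of the tuples in [P] belong to [S'], so [P] has at most [#|S'| ^ k.+1] elements. *)
pose S' := [set x | [exists xs in P, [exists i, xs i == x]]].
have sS' : S' \subset S.
  apply/subsetP => x; rewrite inE => /exists_inP[xs]; rewrite inE => /andP[/tuplesP xsS _].
  by case/existsP => i /eqP <-.
have PS' : #|P| <= #|S'| ^ k.+1.
  rewrite -card_tuples; apply: subset_leq_card; apply/subsetP => xs xsP.
  apply/tuplesP => i; rewrite inE; apply/exists_inP; exists xs => //.
  by apply/existsP; exists i.
(* [|S|^(k+1) <= 2^(k+1) |S'|^(k+1)] *)
have half : #|S| <= 2 * #|S'|.
  rewrite -(@leq_exp2r _ _ k.+1) // expnMn -card_tuples.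
  by apply: leq_trans hz _; rewrite leq_mul2l PS' orbT.
have [||//|[a sa [ha hcov]]] := IH (S :\: S').
- exact: subset_trans (subsetDl _ _) sS.
- by rewrite cardsD (setIidPr sS'); move: hS; rewrite expnS; lia.
- by left.
have [xs0 xs0P] : exists xs0, xs0 \in P.
  have hpos : 0 < #|tuples S| by rewrite card_tuples expn_gt0 card_gt0 nS.
  by apply/card_gt0P; move: hz; case: #|P| => // ; lia.
right; exists ((y, z) :: a) => //; split=> [p|x xS].
  rewrite inE => /orP[/eqP->|/ha //]; split; first exact: (subsetP sY').
  move: xs0P; rewrite inE => /andP[/(sub _ _ sS) h0 /eqP h1].
  by exists xs0.
have [xS'|xS'] := boolP (x \in S').
  move: xS'; rewrite inE => /exists_inP[xs]; rewrite inE => /andP[/(sub _ _ sS) h0 /eqP h1].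
  case/existsP => i /eqP hi; exists xs => //; split; first by exists i.
  by exists (y, z); rewrite ?mem_head.
have [|xs xsS [hi [p pa hp]]] := hcov x; first by rewrite inE xS'.
by exists xs => //; split=> //; exists p; rewrite // inE pa orbT.
Qed.
End Dichotomy.

(** * The length-increasing reduction *)

Lemma tape_enc w v off : (forall i, i < size v -> nth false w (off + i) = nth false v i) ->
  [seq tsym w a | a <- map inr (iota off (size v))] = enc v.
Proof.
move=> h; rewrite -map_comp; apply: (@eq_from_nth _ Blank); rewrite !size_map ?size_iota // => i hi.
by rewrite [RHS](nth_map false) // (nth_map 0) ?size_iota // nth_iota //= h.
Qed.

Lemma FP_circuits f : FP f -> exists c, (forall N K, cc N ((N + K).+2 ^ c) (fun w => code K (f w))) /\
  forall w, size (f w) <= (size w).+2 ^ c.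
Proof.
case=> M [p [pp hM]]; have [d hd] := poly_fun_polyb pp; have [c0 hc0] := cc_tm_run M.
have [c1 h1] : polyb (fun N => (N + N.+2 ^ d).+2 ^ c0) by solve_polyb.
have [c2 h2] : polyb (fun N => (N + N.+2 ^ d).+1) by solve_polyb.
exists (c1 + c2); split=> [N K|w].
  apply: cc_ext (cc_le _ (hc0 N (map inr (iota 0 N)) (p N) K)) => [w hw|].
    by rewrite -{1}hw tape_enc // -{1}hw (hM w).2.
  rewrite size_map size_iota; apply: leq_trans (_ : (N + K).+2 ^ c1 <= _); last first.
    by rewrite leq_exp2l // leq_addr.
  apply: leq_trans (h1 _); apply: leq_exp_base; have := hd N.
  have : N.+2 ^ d <= (N + K).+2 ^ d by apply: leq_exp_base; rewrite !ltnS leq_addr.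
  lia.
rewrite -(hM w).2; apply: leq_trans (size_output _ _ _) _; rewrite size_map.
apply: leq_trans (_ : (size w).+2 ^ c2 <= _); last by rewrite leq_exp2l // leq_addl.
by apply: leq_trans (h2 _); rewrite ltnS leq_add2l.
Qed.

Lemma NP_circuits L : NP L -> exists q V c, polyb q /\ forall n,
  bc (n + q n) (n.+2 ^ c) (V n) /\
  forall x, size x = n -> (L x <-> exists2 u, size u = q n & V n (x ++ u)).
Proof.
case=> M [p [q [pp [pq [hM hL]]]]].
have [d hd] := poly_fun_polyb pp; have qq := poly_fun_polyb pq; have [c0 hc0] := cc_tm_run M.
have [s hs] := bc_local 4.
pose ts n : seq (sym + nat) := map inr (iota 0 n) ++ inl Sep :: map inr (iota n (q n)).
pose out n w := code 2 (tm_output (tm_run M [seq tsym w a | a <- ts n] (p n))).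
(* This is [code 2 [:: true]]: the invalid second cell excludes longer outputs. *)
pose V n w := out n w == [:: true; true; false; false].
have [c hc] : polyb (fun n => (n + (q n).+1 + p n + 2).+2 ^ c0 + s).
  by have ppp := poly_fun_polyb pp; solve_polyb.
exists q, V, c; split=> // n; split.
  apply: cc_le (hc n) _.
  apply: (@cc_comp _ 4 _ _ (out n) (fun v => [:: v == [:: true; true; false; false]])).
  - by apply: cc_le (hc0 _ _ _ _); rewrite size_cat /= !size_map !size_iota.
  - by move=> w _; rewrite size_code.
  exact: hs.
have tape x u : size x = n -> size u = q n -> [seq tsym (x ++ u) a | a <- ts n] = enc_pair x u.
  move=> hx hu; rewrite /ts map_cat map_cons -{1}hx -hu !tape_enc //.
    by move=> i hi; rewrite -hx nth_cat ltnNge leq_addr /= addKn.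
  by move=> i hi; rewrite add0n nth_cat hi.
have VE x u : size x = n -> size u = q n ->
    V n (x ++ u) = (tm_output (tm_run M (enc_pair x u) (p n)) == [:: true]).
  by move=> hx hu; rewrite /V /out tape //; case: tm_output => [|[] [|b z]].
move=> x hx; rewrite hL hx; split=> [[u [hu /eqP ho]]|[u hu]]; first by exists u; rewrite ?VE.
by rewrite VE // => /eqP ho; exists u.
Qed.

(** * Slices of bit strings and the disjunctive question *)

Definition slice off len (z : seq bool) := take len (drop off z).

Lemma size_slice off len z : off + len <= size z -> size (slice off len z) = len.
Proof. by move=> h; rewrite size_takel // size_drop; lia. Qed.

Lemma slice_catl off len s z : off + len <= size s -> slice off len (s ++ z) = slice off len s.
Proof.
move=> h; rewrite /slice drop_cat; case: ltnP => ho; last first.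
  have -> : len = 0 by lia.
  by rewrite !take0.
by rewrite takel_cat // size_drop; lia.
Qed.

Lemma slice_catr off len s z : slice (size s + off) len (s ++ z) = slice off len z.
Proof. by rewrite /slice drop_cat ltnNge leq_addr /= addKn. Qed.

Lemma slice_cat off len s z r : off = size s -> len = size z -> slice off len (s ++ z ++ r) = z.
Proof. by move=> -> ->; rewrite /slice drop_size_cat // take_size_cat. Qed.

Lemma cc_slice I off len : off + len <= I -> cc I (len * 2) (slice off len).
Proof.
move=> h; have := cc_sel I (iota off len); rewrite size_iota.
by apply: cc_ext => z hz; rewrite map_nth_iota // hz; lia.
Qed.

Lemma bc_eq I s s' k F G : cc I s F -> cc I s' G ->
  (forall x, size x = I -> size (F x) = k) -> (forall x, size x = I -> size (G x) = k) ->
  bc I (2 + k * (s + s' + s + s' + 100)) (fun x => F x == G x).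
Proof.
move=> hF hG zF zG.
have hi i : bc I (s + s' + s + s' + 96) (fun x => nth false (F x) i == nth false (G x) i).
  apply: bc_ext (cc_le _ (bc_if (bc_nth i hF) (bc_nth i hG) (bc_not (bc_nth i hG)))).
    by move=> x _; case: (nth false (F x) i); case: (nth false (G x) i).
  lia.
have := @bc_all _ I _ (iota 0 k) (fun i x => nth false (F x) i == nth false (G x) i) (fun i _ => hi i).
rewrite size_iota => h; apply: bc_ext (cc_le _ h) => [x hx|]; last lia.
apply/allP/eqP => [e|-> i _]; last exact: eqxx.
apply: (@eq_from_nth _ false); rewrite ?zF ?zG // => i hlt.
by apply/eqP/e; rewrite mem_iota.
Qed.

(* One more than the length of [code n.+1 z], as [dichotomy] requires. *)
Definition ntup n := (n.+1 * 2).+1.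
Definition nbits n := ntup n * n.

(** The circuit for [D] is compiled into an instance of [U], and [h n] applies a reduction of [U] to
    [A] to that instance. The leading bit of [y] is the flag that switches the question about [B]
    on. *)
Lemma OR_reduction A B L : NP_complete A -> NP B -> coNP L ->
  exists (h : nat -> seq bool -> seq bool) c, forall n,
   (forall K, cc (nbits n + n.+1) ((n + K).+2 ^ c) (fun v => code K (h n v))) /\
   forall X y, size X = nbits n -> size y = n.+1 ->
     size (h n (X ++ y)) <= n.+2 ^ c /\
     (A (h n (X ++ y)) <-> (exists2 j, j < ntup n & ~ L (slice (j * n) n X)) \/
                           (nth false y 0 /\ B (behead y))).
Proof.
case=> _ hardA NPB /NP_circuits[q1 [V1 [c1 [pq1 h1]]]].
have [q2 [V2 [c2 [pq2 h2]]]] := NP_circuits NPB.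
have [U [NPU [c3 hU]]] := circuit_problem.
have [f [FPf hf]] := hardA _ NPU.
have [c4 [hf1 hf2]] := FP_circuits FPf.
pose I n := nbits n + n.+1.
pose k n := ntup n * q1 n + q2 n.
(* Layout of [z]: the tuple, the flag and string of [y], one witness block per entry of the tuple,
   and a last block for [B]. *)
pose D n z :=
  has (fun j => V1 n (slice (j * n) n z ++ slice (I n + j * q1 n) (q1 n) z)) (iota 0 (ntup n))
  || (nth false z (nbits n) && V2 n (slice (nbits n).+1 n z ++ slice (I n + ntup n * q1 n) (q2 n) z)).
pose s n := 2 + ntup n * (n * 2 + q1 n * 2 + n.+2 ^ c1 + 4) +
  (2 + (n * 2 + q2 n * 2 + n.+2 ^ c2) + 4) + 4.
have hD n : bc (I n + k n) (s n) (D n).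
  apply: bc_or.
    rewrite -{1}(size_iota 0 (ntup n)); apply: (@bc_has _ _ _ _ (fun j z => _)) => j.
    rewrite mem_iota add0n /= => hj.
    have hjn : j * n + n <= nbits n by rewrite addnC -mulSn leq_mul2r hj orbT.
    have hjq : j * q1 n + q1 n <= ntup n * q1 n by rewrite addnC -mulSn leq_mul2r hj orbT.
    apply: (@cc_comp _ (n + q1 n) _ _ _ (fun w => [:: V1 n w])); last exact: (h1 n).1.
      by apply: cc_cat; apply: cc_slice; rewrite /k /I; lia.
    by move=> z hz; rewrite size_cat !size_slice // hz /k /I; lia.
  apply: bc_and; first exact: bc_in.
  apply: (@cc_comp _ (n + q2 n) _ _ _ (fun w => [:: V2 n w])); last exact: (h2 n).1.
    by apply: cc_cat; apply: cc_slice; rewrite /k /I; lia.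
  by move=> z hz; rewrite size_cat !size_slice // hz /k /I; lia.
have semD n X y : size X = nbits n -> size y = n.+1 ->
    ((exists2 u, size u = k n & D n ((X ++ y) ++ u)) <->
     (exists2 j, j < ntup n & ~ L (slice (j * n) n X)) \/ (nth false y 0 /\ B (behead y))).
  move=> hX hy; have hXy : size (X ++ y) = I n by rewrite size_cat hX hy.
  have e0 u : nth false ((X ++ y) ++ u) (nbits n) = nth false y 0.
    by rewrite -catA nth_cat hX ltnn subnn; case: y hy {hXy}.
  have ey u : slice (nbits n).+1 n ((X ++ y) ++ u) = behead y.
    rewrite -catA -addn1 -hX slice_catr /slice; case: y hy {hXy e0} => // b y [hy].
    by rewrite /= drop0 take_size_cat.
  have ex u j : j < ntup n -> slice (j * n) n ((X ++ y) ++ u) = slice (j * n) n X.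
    move=> hj; rewrite -catA slice_catl // hX addnC -mulSn; exact: leq_mul.
  have szx j : j < ntup n -> size (slice (j * n) n X) = n.
    move=> hj; rewrite size_slice // hX addnC -mulSn; exact: leq_mul.
  split=> [[u hu]|[[j hj hL]|[y0 /(proj1 ((h2 n).2 _ _))]]].
  - case/orP=> [/hasP[j]|/andP[]].
      rewrite mem_iota add0n /= => hj; rewrite ex // => hV; left; exists j => //.
      apply/((h1 n).2 _ (szx _ hj)); exists (slice (I n + j * q1 n) (q1 n) ((X ++ y) ++ u)) => //.
      rewrite size_slice // size_cat hXy hu /k.
      have : j * q1 n + q1 n <= ntup n * q1 n by rewrite addnC -mulSn leq_mul2r hj orbT.
      lia.
    rewrite e0 ey => y0 hV; right; split=> //.
    apply/((h2 n).2 (behead y)); first by rewrite size_behead hy.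
    exists (slice (I n + ntup n * q1 n) (q2 n) ((X ++ y) ++ u)) => //.
    by rewrite size_slice // size_cat hXy hu /k; lia.
  - have [w hw hV] := proj1 ((h1 n).2 _ (szx _ hj)) hL.
    have hjq : j * q1 n + q1 n <= ntup n * q1 n by rewrite addnC -mulSn leq_mul2r hj orbT.
    exists (nseq (j * q1 n) false ++ w ++ nseq (k n - (j * q1 n + q1 n)) false).
      by rewrite !size_cat !size_nseq hw /k; lia.
    apply/orP; left; apply/hasP; exists j; first by rewrite mem_iota.
    by rewrite ex // -hXy slice_catr slice_cat ?size_nseq.
  rewrite size_behead hy => /(_ (erefl _))[w hw hV].
  exists (nseq (ntup n * q1 n) false ++ w); first by rewrite size_cat size_nseq hw.
  apply/orP; right; rewrite e0 y0 ey -hXy slice_catr.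
  by rewrite -[w]cats0 slice_cat ?size_nseq // cats0.
have pt : polyb ntup by rewrite /ntup; solve_polyb.
have pnb : polyb nbits by rewrite /nbits; solve_polyb.
have [c5 h5] : polyb (fun n => (I n + k n + s n).+2 ^ c3) by rewrite /I /k /s; solve_polyb.
have [c6 h6] : polyb (fun n => (n.+2 ^ c5).+2 ^ c4) by solve_polyb.
have [c7 h7] : polyb (fun n => n.+2 ^ c5 + (n.+2 ^ c5 + n).+2 ^ c4) by solve_polyb.
have [prog hprog] := functional_choice _ (fun n => hU _ _ _ _ (hD n)).
exists (fun n v => f (prog n v)), (c6 + c7) => n.
have [len [hlen hcc hsem]] := hprog n; split=> [K|X y hX hy].
  apply: cc_le (cc_comp hcc (fun v hv => (hsem v hv).1) (hf1 len K)).
  apply: leq_trans (_ : (n + K).+2 ^ c7 <= _); last by rewrite leq_exp2l // leq_addl.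
  have hn : (n.+2 <= (n + K).+2) by rewrite !ltnS leq_addr.
  apply: leq_trans (h7 _); apply: leq_add.
    by apply: leq_trans (h5 n) _; apply: leq_exp_base.
  apply: leq_exp_base; rewrite !ltnS; apply: leq_add; last by rewrite leq_addl.
  by apply: leq_trans hlen (leq_trans (h5 n) _); apply: leq_exp_base.
have hv : size (X ++ y) = I n by rewrite size_cat hX hy.
have [hl hUv] := hsem _ hv; split.
  apply: leq_trans (hf2 _) _; apply: leq_trans (_ : n.+2 ^ c6 <= _); last first.
    by rewrite leq_exp2l // leq_addr.
  apply: leq_trans (h6 n); apply: leq_exp_base; rewrite hl !ltnS.
  exact: leq_trans hlen (h5 n).
by rewrite -hf hUv; apply: semD.
Qed.

Lemma slice_flatten (T : Type) (x0 : T) n (F : T -> seq bool) r j :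
  (forall i, size (F i) = n) -> j < size r ->
  slice (j * n) n (flatten [seq F i | i <- r]) = F (nth x0 r j).
Proof.
move=> hF; elim: r j => //= i r IH [|j] hj.
  by rewrite /slice drop0 take_size_cat.
by rewrite mulSn -{1}(hF i) slice_catr IH.
Qed.

Lemma nth_code K z i : i < K -> nth false (code K z) (i * 2) = (i < size z).
Proof.
move=> hi; rewrite -[i * 2]addn0 /code (@nth_flatten_const _ _ 0) ?size_iota //.
by rewrite nth_iota.
Qed.

(** The spare cell of [code K.+1] shows whether the string goes beyond length [K]. *)
Lemma code_short K z z' : code K.+1 z = code K.+1 z' -> size z <= K -> z' = z.
Proof.
move/code_inj=> e hz; rewrite take_oversize in e; last by rewrite (leq_trans hz).
have := congr1 size e; rewrite size_take_min => e'.
by rewrite e take_oversize //; lia.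
Qed.

Lemma decidable_pred (T : Type) (P : T -> Prop) : exists b : T -> bool, forall x, b x <-> P x.
Proof.
apply: (functional_choice (fun x (b : bool) => b <-> P x)) => x.
by have [p|np] := classic (P x); [exists true | exists false].
Qed.

Lemma nbits_poly : poly_fun nbits.
Proof.
exists [:: 0; 3; 2] => n; rewrite !big_ord_recl big_ord0 /= /bump /= /nbits /ntup.
by rewrite expn0 expn1; nia.
Qed.

(** An [NPpoly] family is indexed by the joint length of input and witness; [n] has to be recovered
    from it. *)
Lemma nbits_inj n n' : n + nbits n = n' + nbits n' -> n = n'.
Proof.
wlog le : n n' / n <= n' => [h e|].
  by have [le|le] := leqP n n'; [apply: h | symmetry; apply: h; rewrite // ltnW].
have : nbits n <= nbits n' by apply: leq_mul; rewrite // ltnS leq_mul2r ltnS le orbT.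
by lia.
Qed.

(** * Lengths at which [L] has no short nondeterministic advice *)

Section Reduction.
Variables (L A B : language) (h : nat -> seq bool -> seq bool) (c : nat).
Hypothesis h_cc : forall n K, cc (nbits n + n.+1) ((n + K).+2 ^ c) (fun v => code K (h n v)).
Hypothesis h_size : forall n X y, size X = nbits n -> size y = n.+1 -> size (h n (X ++ y)) <= n.+2 ^ c.
Hypothesis h_sem : forall n X y, size X = nbits n -> size y = n.+1 ->
  (A (h n (X ++ y)) <-> (exists2 j, j < ntup n & ~ L (slice (j * n) n X)) \/
                        (nth false y 0 /\ B (behead y))).
Hypothesis L_hard : ~ ioNPpoly L.

Definition all_in n X := forall j, j < ntup n -> L (slice (j * n) n X).

Definition passes n (a : seq (seq bool * seq bool)) x X :=
  has (fun j => x == slice (j * n) n X) (iota 0 (ntup n)) &&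
  has (fun p => code n.+1 (h n (X ++ p.1)) == p.2) a.

(* [a] is advice deciding [L] at length [n] nondeterministically: [x] is in [L]
   iff some tuple containing [x] is mapped to an output listed in [a]. *)
Definition good n (a : seq (seq bool * seq bool)) :=
  [/\ size a <= n.+1, forall p, p \in a -> size p.1 = n.+1 /\ size p.2 = n.+1 * 2 &
   forall x, size x = n -> (L x <-> exists2 X, size X = nbits n & passes n a x X)].

Lemma bc_passes : exists2 S, polyb S & forall n a, size a <= n.+1 ->
  (forall p, p \in a -> size p.1 = n.+1 /\ size p.2 = n.+1 * 2) ->
  bc (n + nbits n) (S n) (fun w => passes n a (slice 0 n w) (slice n (nbits n) w)).
Proof.
pose s1 n := 2 + ntup n * (2 + n * (n * 2 + n * 2 + n * 2 + n * 2 + 100) + 4).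
pose s2 n := nbits n * 2 + n.+1 * 2 + (n + n.+1).+2 ^ c.
pose s3 n := 2 + n.+1 * 2 * (s2 n + n.+1 * 2 * 2 + s2 n + n.+1 * 2 * 2 + 100).
exists (fun n => s1 n + (2 + n.+1 * (s3 n + 4)) + 4).
  have pt : polyb ntup by rewrite /ntup; solve_polyb.
  have pnb : polyb nbits by rewrite /nbits; solve_polyb.
  by rewrite /s1 /s3 /s2; solve_polyb.
move=> n a ha hp; apply: bc_and.
  have hj j : j \in iota 0 (ntup n) -> bc (n + nbits n) (2 + n * (n * 2 + n * 2 + n * 2 + n * 2 + 100))
      (fun w => slice 0 n w == slice (j * n) n (slice n (nbits n) w)).
    rewrite mem_iota add0n /= => hj.
    have hjn : j * n + n <= nbits n by rewrite addnC -mulSn leq_mul2r hj orbT.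
    have e w : size w = n + nbits n -> slice (j * n) n (slice n (nbits n) w) = slice (n + j * n) n w.
      move=> hw; rewrite {2}/slice take_oversize ?size_drop ?hw; last by lia.
      by rewrite /slice drop_drop addnC.
    apply: (@bc_ext _ _ (fun w => slice 0 n w == slice (n + j * n) n w)) => [w hw|].
      by rewrite e.
    apply: bc_eq; try apply: cc_slice; try lia;
      by move=> w hw; rewrite size_slice // hw; lia.
  have := bc_has hj; rewrite size_iota; exact: cc_le.
have hh p : p \in a -> bc (n + nbits n) (s3 n)
    (fun w => code n.+1 (h n (slice n (nbits n) w ++ p.1)) == p.2).
  move=> /hp[h1 h2]; apply: bc_eq => [|||w _]; last 2 first.
  - by move=> w _; rewrite size_code.
  - exact: h2.
  - apply: (@cc_comp _ (nbits n + n.+1) (nbits n * 2 + n.+1 * 2) ((n + n.+1).+2 ^ c)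
      (fun w => slice n (nbits n) w ++ p.1) (fun v => code n.+1 (h n v)) _ _ (h_cc n n.+1)).
    + apply: cc_cat; first by apply: cc_slice.
      by rewrite -h1; apply: cc_const.
    + by move=> w hw; rewrite size_cat size_slice ?hw ?h1.
  by rewrite -h2; apply: cc_const.
by apply: cc_le (bc_has hh); rewrite leq_add2l leq_mul2r ha orbT.
Qed.

(** Good advice at infinitely many lengths would define an [NPpoly] language equal to [L] at those
    lengths. Other lengths get the empty advice, which keeps the circuits small there. *)
Lemma eventually_no_good : exists m, forall n, m <= n -> forall a, ~ good n a.
Proof.
apply: NNPP => hno; apply: L_hard.
have [a ha] := functional_choice (fun n a => good n a \/ (a = [::] /\ forall a', ~ good n a'))
  (fun n => match classic (exists a, good n a) with
    | or_introl (ex_intro a g) => ex_intro _ a (or_introl g)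
    | or_intror g => ex_intro _ [::] (or_intror (conj erefl (fun a' g' => g (ex_intro _ a' g'))))
    end).
pose test n w := passes n (a n) (slice 0 n w) (slice n (nbits n) w).
have [S pS hS] := bc_passes.
have hC n : exists C, csize C <= S n /\ forall w, size w = n + nbits n -> caccepts C w = test n w.
  have [||C [_ sz hC]] := hS n (a n); try by case: (ha n) => [[]|[->]].
  by exists C; split=> // w hw; rewrite /caccepts hC.
have [C {}hC] := functional_choice _ hC.
(* Inverse of [n + nbits n] by search. On other lengths it is 0, so [idx N <= N] always holds and
   the family stays polynomial. *)
pose idx N := head 0 [seq n <- iota 0 N.+1 | n + nbits n == N].
have idxE n : idx (n + nbits n) = n.
  have hn : n \in [seq n' <- iota 0 (n + nbits n).+1 | n' + nbits n' == n + nbits n].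
    by rewrite mem_filter eqxx mem_iota add0n /= ltnS leq_addr.
  rewrite /idx; case E: [seq _ <- _ | _] hn => [//|n' s] _.
  have : n' \in [seq n' <- iota 0 (n + nbits n).+1 | n' + nbits n' == n + nbits n].
    by rewrite E mem_head.
  by rewrite mem_filter => /andP[/eqP/nbits_inj].
pose U x := exists y, size y = nbits (size x) /\ caccepts (C (idx (size (x ++ y)))) (x ++ y).
exists U; split.
  exists (fun N => C (idx N)), nbits; split; last by split=> //; exact: nbits_poly.
  have [cS hcS] := pS; have [q [pq hq]] := @polyb_poly_fun (fun N => N.+2 ^ cS) ltac:(by exists cS).
  exists q; split=> // N; apply: leq_trans (hC _).1 _; apply: leq_trans (hcS _) _.
  apply: leq_trans (hq N); apply: leq_exp_base; rewrite !ltnS /idx.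
  case E: [seq _ <- _ | _] => [//|n s] /=.
  have : n \in [seq n <- iota 0 N.+1 | n + nbits n == N] by rewrite E mem_head.
  by rewrite mem_filter mem_iota add0n ltnS => /andP[_ /andP[]].
move=> m; apply: NNPP => hm; apply: hno; exists m => n hn a' ga'; apply: hm.
exists n; split=> // x hx.
case: (ha n) => [[_ _ ->] //|[_ hn']]; last by case: (hn' a').
have eqt X : size X = nbits n -> test n (x ++ X) = passes n (a n) x X.
  move=> hX; rewrite /test; congr passes; first by rewrite /slice drop0 take_size_cat.
  by rewrite -{1}hx -[size x]addn0 slice_catr /slice drop0 take_oversize ?hX.
rewrite /U hx; split=> [[X hX hp]|[X [hX]]].
  exists X; split=> //; rewrite size_cat hx hX idxE (hC n).2 ?eqt //.
  by rewrite size_cat hx hX.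
by rewrite size_cat hx hX idxE (hC n).2 ?eqt ?size_cat ?hx ?hX // => hp; exists X.
Qed.

Section Length.
Variable n : nat.
Hypothesis no_good : forall a, ~ good n a.
Local Notation tup := {ffun 'I_(ntup n) -> n.-tuple bool}.

Definition flat (xs : tup) : seq bool := flatten [seq tval (xs i) | i <- enum 'I_(ntup n)].

Lemma size_flat xs : size (flat xs) = nbits n.
Proof. by rewrite (@size_flatten_const _ _ n) ?size_enum_ord // => i _; apply: size_tuple. Qed.

Lemma slice_flat xs (j : 'I_(ntup n)) : slice (j * n) n (flat xs) = xs j.
Proof.
rewrite /flat (slice_flatten j) ?size_enum_ord // => [|i]; last exact: size_tuple.
by rewrite nth_ord_enum.
Qed.

Definition code_tuple (z : seq bool) : (n.+1 * 2).-tuple bool :=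
  Tuple (introT eqP (size_code n.+1 z)).

Lemma all_in_flat (S : {set n.-tuple bool}) xs :
  (forall x, x \in S -> L x) -> xs \in tuples (n.+1 * 2) S -> all_in n (flat xs).
Proof.
move=> hS /tuplesP hxs j hj.
by rewrite (slice_flat xs (Ordinal hj)); apply: hS.
Qed.

Lemma not_A X y : size X = nbits n -> size y = n.+1 -> all_in n X ->
  ~ (nth false y 0 /\ B (behead y)) -> ~ A (h n (X ++ y)).
Proof. by move=> hX hy hin hB /(h_sem hX hy)[[j /hin]|]. Qed.

(** Coverage comes from the counting argument, which speaks of tuples over [S] only. Soundness
    concerns every guessed tuple and is a separate hypothesis, because its two uses justify it
    differently. *)
Lemma goodI (S : {set n.-tuple bool}) (a : seq (n.+1.-tuple bool * (n.+1 * 2).-tuple bool)) :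
  (forall x, x \in S <-> L x) -> size a <= n.+1 ->
  (forall p, p \in a -> forall X, size X = nbits n ->
     code n.+1 (h n (X ++ p.1)) = p.2 -> all_in n X) ->
  (forall x, x \in S -> exists2 xs, xs \in tuples (n.+1 * 2) S & (exists i, xs i = x) /\
     exists2 p, p \in a & code n.+1 (h n (flat xs ++ p.1)) = p.2) ->
  exists a', good n a'.
Proof.
move=> hS sa hsound hcov.
exists [seq (tval p.1, tval p.2) | p <- a]; split; first by rewrite size_map.
  by move=> _ /mapP[p _ ->]; rewrite !size_tuple.
move=> x /eqP hx; split=> [Lx|[X hX /andP[/hasP[j]]]].
  have [|xs xsS [[i hi] [p pa hp]]] := hcov (Tuple hx); first by apply/hS.
  exists (flat xs); first exact: size_flat.
  apply/andP; split; apply/hasP.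
    by exists (i : nat); rewrite ?mem_iota ?add0n ?ltn_ord // slice_flat hi.
  by exists (tval p.1, tval p.2); [apply/mapP; exists p | rewrite /= hp].
rewrite mem_iota add0n /= => hj /eqP -> /hasP[_ /mapP[p pa ->] /eqP hp].
exact: hsound pa _ hX hp _ hj.
Qed.

Lemma card_words k : #|[set: k.-tuple bool]| = 2 ^ k.
Proof. by rewrite cardsT card_tuple card_bool. Qed.

Lemma card_words_lt k (S : {set k.-tuple bool}) : #|S| < 2 ^ k.+1.
Proof.
apply: leq_ltn_trans (subset_leq_card (subsetT S)) _.
by rewrite card_words ltn_exp2l.
Qed.

(** Long outputs count as success. A listed output is therefore short, and its code determines it;
    it lies outside [A], since it arises from a tuple over [L] and a negative [y]. Any guessed tuple
    with this code thus has an output outside [A], so all its entries are in [L]. *)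
Lemma long_tuples : exists2 r : seq (seq bool), size r <= n.+2 &
  (forall X, X \in r -> size X = nbits n /\ all_in n X) /\
  forall y, size y = n.+1 -> ~ (nth false y 0 /\ B (behead y)) ->
    exists2 X, X \in r & n < size (h n (X ++ y)).
Proof.
have [dL hL] := decidable_pred (fun x : n.-tuple bool => L x).
have [dB hB] := decidable_pred (fun y : n.+1.-tuple bool => nth false y 0 /\ B (behead y)).
pose S := [set x | dL x]; pose Y := [set y | ~~ dB y].
have hS x : x \in S <-> L x by rewrite inE.
pose out (xs : tup) (y : n.+1.-tuple bool) :=
  let z := h n (flat xs ++ y) in if n < size z then None else Some (code_tuple z).
have cZ : #|{: (n.+1 * 2).-tuple bool}| <= 2 ^ (n.+1 * 2) by rewrite card_tuple card_bool.
have [[r sr [rS hr]]|[a sa [ha hcov]]] := dichotomy cZ out (card_words_lt S) (card_words_lt Y).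
  exists (map flat r); first by rewrite size_map.
  split=> [X /mapP[xs /rS xsS ->]|y /eqP hy hyB].
    split; [exact: size_flat | apply: all_in_flat xsS => x; exact: (hS x).1].
  have [|xs xsr] := hr (Tuple hy).
    by rewrite inE; apply/negP => /hB.
  rewrite /out; case: ltnP => // hlt _; exists (flat xs) => //; exact: map_f.
have [] : exists a', good n a'; last by move=> a' /no_good.
apply: (goodI hS sa) => [p pa X hX hp|x xS].
  have [pY [xs xsS]] := ha p pa; rewrite /out; case: ltnP => // hsz [hz].
  have hp2 : code n.+1 (h n (flat xs ++ p.1)) = code n.+1 (h n (X ++ p.1)) by rewrite hp -hz.
  have e := code_short hp2 hsz.
  have hB' : ~ (nth false p.1 0 /\ B (behead p.1)) by move/hB; move: pY; rewrite inE => /negP.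
  have := not_A (size_flat xs) (size_tuple p.1) (all_in_flat (fun x => (hS x).1) xsS) hB'.
  rewrite -e => nA j hj; apply: NNPP => nL; apply/nA/h_sem; rewrite ?size_tuple //.
  by left; exists j.
have [xs xsS [hi [p pa]]] := hcov x xS; rewrite /out; case: ltnP => // _ [hz].
by exists xs => //; split=> //; exists p => //; rewrite -hz.
Qed.

(** The counting is repeated with the single all-zero [y], negative by its flag, and with no output
    counted as success. If no output in [A] were long, a guessed tuple with an entry outside [L]
    would have a short output, determined by its code; it would equal the output of a tuple over
    [L], which is not in [A]. *)
Lemma long_member : exists z, [/\ A z, n < size z & size z <= n.+2 ^ c].
Proof.
apply: NNPP => hno.
have short X y : size X = nbits n -> size y = n.+1 -> A (h n (X ++ y)) -> size (h n (X ++ y)) <= n.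
  move=> hX hy hA; rewrite leqNgt; apply/negP => hlt; apply: hno.
  by exists (h n (X ++ y)); split=> //; apply: h_size.
have [dL hL] := decidable_pred (fun x : n.-tuple bool => L x).
pose S := [set x | dL x].
have hS x : x \in S <-> L x by rewrite inE.
pose y0 : n.+1.-tuple bool := nseq_tuple n.+1 false.
pose out (xs : tup) (y : n.+1.-tuple bool) := Some (code_tuple (h n (flat xs ++ y))).
have cZ : #|{: (n.+1 * 2).-tuple bool}| <= 2 ^ (n.+1 * 2) by rewrite card_tuple card_bool.
have cY : #|[set y0]| < 2 ^ 1 by rewrite cards1.
have [[r _ [_ hr]]|[a sa [ha hcov]]] := dichotomy cZ out (card_words_lt S) cY.
  by have [|xs] := hr y0; first by rewrite inE.
have [] : exists a', good n a'; last by move=> a' /no_good.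
apply: (goodI hS sa) => [p pa X hX hp|x xS].
  have [] := ha p pa; rewrite inE => /eqP py [xs xsS] [hz] j hj; apply: NNPP => nL.
  have hA : A (h n (X ++ p.1)) by apply/h_sem; rewrite ?size_tuple //; left; exists j.
  have hp2 : code n.+1 (h n (flat xs ++ p.1)) = code n.+1 (h n (X ++ p.1)) by rewrite hp -hz.
  have e := code_short (esym hp2) (short _ _ hX (size_tuple _) hA).
  move: hA; rewrite -e; apply: not_A; rewrite ?size_flat ?size_tuple //.
    by apply: all_in_flat xsS => x; exact: (hS x).1.
  by rewrite py; case.
have [xs xsS [hi [p pa [hz]]]] := hcov x xS.
by exists xs => //; split=> //; exists p => //; rewrite -hz.
Qed.
End Length.
End Reduction.

(** * The circuits of the reduction *)

Definition first_long (h : seq bool -> seq bool) n (r : seq (seq bool)) z x :=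
  foldr (fun X acc => if n < size (h (X ++ true :: x)) then h (X ++ true :: x) else acc) z r.

Lemma first_longP h n r z x :
  (exists2 X, X \in r & n < size (h (X ++ true :: x)) /\
     first_long h n r z x = h (X ++ true :: x)) \/
  ((forall X, X \in r -> size (h (X ++ true :: x)) <= n) /\ first_long h n r z x = z).
Proof.
elim: r => [|X r IH] /=; first by right.
case: ltnP => hX; first by left; exists X; rewrite ?mem_head.
case: IH => [[X' hX' e]|[hr e]]; [left; exists X' | right] => //.
  by rewrite inE hX' orbT.
by split=> // X'; rewrite inE => /orP[/eqP->|/hr].
Qed.

Lemma cc_first_long c h N n K r z : (forall K, cc (N + n.+1) ((n + K).+2 ^ c) (fun v => code K (h v))) ->
  (forall X, X \in r -> size X = N) ->
  let s := N * 2 + (2 + n * 2) in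
  cc n (K * 2 * 2 + size r * (s + (n + n.+1).+2 ^ c + 2 + (s + (n + K).+2 ^ c) + K * 2 * 23))
    (fun x => code K (first_long h n r z x)).
Proof.
move=> hcc hr s; elim: r hr => [|X r IH] hr.
  by have := cc_const n (code K z); rewrite size_code addn0.
have hX : size X = N by apply: hr; rewrite mem_head.
have pre : cc n s (fun x => X ++ true :: x).
  apply: cc_cat; first by rewrite -hX; apply: cc_const.
  apply: (@cc_cat n 2 (n * 2) (fun=> [:: true]) id); first exact: bc_const.
  apply: cc_ext (@cc_slice n 0 n _) => // x hx.
  by rewrite /slice drop0 take_oversize // hx.
have spre x : size x = n -> size (X ++ true :: x) = N + n.+1 by rewrite size_cat /= hX => ->.
(* Bit [n * 2] of [code n.+1] is the validity bit of the last cell: it tells whether the length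
   exceeds [n]. *)
have hb := bc_nth (n * 2) (cc_comp pre spre (hcc n.+1)).
have hK := cc_comp pre spre (hcc K).
have hI := IH (fun X' hX' => hr X' (mem_behead (s := X :: r) hX')).
apply: cc_ext (cc_le _ (cc_if (O := K * 2) hb hK hI _ _)) => [x hx||x _|x _]; try exact: size_code.
  by rewrite nth_code //=; case: ifP.
by rewrite /= mulSn; lia.
Qed.

Theorem theorem3p4 :
  (exists L : language, coNP L /\ ~ ioNPpoly L) ->
  forall A : language, NP_complete A ->
  forall B : language, NP B ->
  exists C : nat -> circuit, poly_size C /\
    forall x, (B x <-> A (circ_fun C x)) /\ size x < size (circ_fun C x).
Proof.
case=> L [coNPL L_hard] A NPcA B NPB.
have [h [c hh]] := OR_reduction NPcA NPB coNPL.
have h_cc n := (hh n).1.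
have h_size n X y hX hy := ((hh n).2 X y hX hy).1.
have h_sem n X y hX hy := ((hh n).2 X y hX hy).2.
have [m hm] := eventually_no_good h_cc L_hard.
pose correct n C := forall x, size x = n ->
  (B x <-> A (decode (ceval C x))) /\ n < size (decode (ceval C x)).
pose s n := nbits n * 2 + (2 + n * 2).
(* At most [n.+2] tuples are hardwired, and outputs of [h] as well as the fixed element have length
   at most [n.+2 ^ c]. *)
pose S n := n.+2 ^ c * 2 * 2 + n.+2 *
  (s n + (n + n.+1).+2 ^ c + 2 + (s n + (n + n.+2 ^ c).+2 ^ c) + n.+2 ^ c * 2 * 23).
have large n : m <= n -> exists C, csize C <= S n /\ correct n C.
  move=> /hm no_good.
  have [r sr [hr long]] := long_tuples h_sem no_good.
  have [z [Az nz sz]] := long_member h_size h_sem no_good.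
  have [C [_ szC hC]] := cc_first_long (n.+2 ^ c) z (h_cc n) (fun X hX => (hr X hX).1).
  exists C; split=> [|x hx].
    by apply: leq_trans szC _; rewrite leq_add2l leq_mul2r sr orbT.
  have hy : size (true :: x) = n.+1 by rewrite /= hx.
  rewrite hC // decode_code take_oversize; last first.
    case: (first_longP (h n) n r z x) => [[X /hr[hX _] [_ ->]]|[_ ->]] //.
    exact: h_size.
  case: (first_longP (h n) n r z x) => [[X /hr[hX inX] [hlt ->]]|[short ->]].
    split=> //; rewrite (h_sem _ _ _ hX hy); split=> [Bx|[[j /inX]|[]]] //.
    by right.
  split=> //; split=> // _; apply: NNPP => nB.
  have [|X /short] := long (true :: x) hy; first by case.
  by rewrite leqNgt => /negP.
have [z1 [Az1 lz1 _]] := long_member h_size h_sem (hm m (leqnn m)).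
(* The flag of the all-zero string makes the question negative, so a hardwired tuple with a long
   output on it yields a long string outside [A]. *)
have [z0 [Az0 lz0]] : exists z0, ~ A z0 /\ m < size z0.
  have [r _ [hr long]] := long_tuples h_sem (hm m (leqnn m)).
  have nB : ~ (nth false (nseq m.+1 false) 0 /\ B (behead (nseq m.+1 false))) by case.
  have [|X Xr hlt] := long _ (size_nseq m.+1 false); first by case.
  have [hX inX] := hr X Xr; exists (h m (X ++ nseq m.+1 false)); split=> //.
  exact: (@not_A L A B h h_sem m X _ hX (size_nseq _ _) inX nB).
have small n : n < m -> exists C, correct n C.
  move=> hn; have [dB hB] := decidable_pred B.
  pose K := size z0 + size z1.
  have [s0 [C [_ _ hC]]] := @cc_table n (K * 2) (fun x => code K (if dB x then z1 else z0))
    (fun x _ => size_code _ _).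
  exists C => x hx; rewrite hC // decode_code take_oversize; last first.
    by rewrite /K; case: ifP => _; rewrite ?leq_addr ?leq_addl.
  split; last by case: ifP => _; apply: ltn_trans hn _.
  by rewrite -hB; case: (dB x); split.
(* Only finitely many lengths lie below [m], so the sizes of their tables have a common bound. *)
have [T hT] : exists T, forall n, n < m -> exists C, csize C <= T /\ correct n C.
  elim: m small {hm large Az1 lz1 lz0} => [|m' IH] small; first by exists 0.
  have [|T hT] := IH; first by move=> n hn; apply: small; apply: ltnW.
  have [C hC] := small m' (leqnn _).
  exists (T + csize C) => n; rewrite ltnS leq_eqVlt => /orP[/eqP->|/hT[C' [sC' hC']]].
    by exists C; split=> //; apply: leq_addl.
  by exists C'; split=> //; apply: leq_trans sC' (leq_addr _ _).
have [q [pq hq]] : exists q, poly_fun q /\ forall n, S n + T <= q n.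
  apply: (@polyb_poly_fun (fun n => S n + T)); rewrite /S /s.
  have pnb := poly_fun_polyb nbits_poly.
  by solve_polyb.
have all n : exists C, csize C <= q n /\ correct n C.
  have [/hT|/large] := ltnP n m => -[C [sC hC]]; exists C; split=> //;
  by apply: leq_trans (hq n); apply: leq_trans sC _; rewrite ?leq_addl ?leq_addr.
have [C hC] := functional_choice _ all.
exists C; split=> [|x]; first by exists q; split=> // n; apply: (hC n).1.
exact: (hC (size x)).2.
Qed.
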